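(* Let $0<\epsilon<1$ and $B>1$, and put $$r=\left\lceil\left(\frac{6(B+1)}{\epsilon}\right)^4\right\rceil\text{ in the real case},\qquad r=\left\lceil\left(\frac{6(B+1)}{\epsilon}\right)^8\right\rceil\text{ in the complex case}.$$ Then for every natural number $n$ and every linear operator $T:\ell_2^n\to\ell_2^n$ with $\|T\|\le B$ and $\|Te_i\|=1$ for all $i=1,\dots,n$, there is a partition $\{S_j\}_{j=1}^r$ of $\{1,\dots,n\}$ (with possibly empty sets) such that for all $j=1,\dots,r$ and all choices of scalars $\{a_i\}_{i\in S_j}$, $$(1-\epsilon)\sum_{i\in S_j}|a_i|^2\le\left\|\sum_{i\in S_j}a_iTe_i\right\|^2\le(1+\epsilon)\sum_{i\in S_j}|a_i|^2 .$$
   Context: $\ell_2^n$ is $n$-dimensional real or complex Hilbert space with standard orthonormal basis $\{e_i\}_{i=1}^n$; ''real case'' and ''complex case'' refer to the scalar field. $\|T\|$ is the operator norm. *)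

(* Defs.v *)
From mathcomp Require Import all_boot all_order all_algebra.
From mathcomp Require Import boolp classical_sets reals.
From mathcomp Require Import complex.

Set Implicit Arguments.
Unset Strict Implicit.
Unset Printing Implicit Defensive.

Import Order.TTheory GRing.Theory Num.Theory.
Local Open Scope ring_scope.

(* The absolute value [abs] on the scalars is a parameter so that the real and
   the complex Hilbert spaces share one definition: [Num.norm] on R[i] takes
   its values in R[i], whereas norms are wanted in R. *)
Definition l2norm (R : realType) (K : nzRingType) (abs : K -> R) (n : nat)
    (x : 'rV[K]_n) : R :=
  Num.sqrt (\sum_(i < n) abs (x 0 i) ^+ 2).

Definition opnorm (R : realType) (K : nzRingType) (abs : K -> R) (n : nat)
    (T : 'rV[K]_n -> 'rV[K]_n) : R :=
  sup [set l2norm abs (T x) | x in [set x | l2norm abs x <= 1]]%classic.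

Definition absR (R : realType) (x : R) : R := `|x|.

Definition absC (R : realType) (z : R[i]) : R := complex.Re `|z|.

Definition std_basis (K : nzRingType) (n : nat) (i : 'I_n) : 'rV[K]_n :=
  delta_mx 0 i.

(* Unlike [finset.partition], this allows empty (hence repeated) blocks. *)
Definition is_partition_family (n r : nat) (S : 'I_r -> {set 'I_n}) : Prop :=
  (forall j k : 'I_r, j != k -> [disjoint S j & S k]) /\
  \bigcup_(j < r) S j = [set: 'I_n].

(* Main.v *)
Require Import Defs.
From mathcomp Require Import all_boot all_order all_algebra.
From mathcomp Require Import reals complex polyrcf ring lra zify.
From mathcomp Require spectral sesquilinear.
From mathcomp Require topology normedtype derive realfun.
From mathcomp Require classical_sets.

Set Implicit Arguments.
Unset Strict Implicit.
Unset Printing Implicit Defensive.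

Import Order.TTheory GRing.Theory Num.Theory.
Local Open Scope ring_scope.

(* The proof runs the interlacing-polynomial argument of Marcus, Spielman and
   Srivastava, in the form due to Leake and Ravichandran, on principal
   submatrices.  For a Hermitian [A] with [0 <= A <= 1] and diagonal at most
   [delta], the sum over all colorings of the products of the characteristic
   polynomials of the color classes is obtained from [det (Z - A) ^ r] by keeping,
   in each variable [z_i] in turn, the top two coefficients [p_r, p_(r-1)] and
   forming [r z_i p_r + p_(r-1)].  These operations preserve stability (no zero
   when all the variables lie in the upper half-plane), and a barrier argument
   shows that each of them lowers by a fixed amount the [i]-th coordinate of a
   point lying above all the zeros.  Interlacing then allows one to choose the
   colors one index at a time, so that some coloring satisfies the bound that
   holds for the sum.

   For the Gram matrix [G] of the vectors [T e_i] (unit diagonal,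
   [0 <= G <= B^2]) a first coloring, applied to [G / B^2], yields blocks with
   [G <= 1 + eps]; a second one, applied to the diagonal blocks of
   [1 - G / (1 + eps)], whose diagonal entries are only [eps / (1 + eps)], yields
   [1 - eps <= G].  About [B^2 / eps^3] colors suffice, far fewer than allowed. *)

(** * Principal minors and products of affine polynomials *)

(** In the variable [z_i] each of the [r] copies of [det (Z - A)] is affine, [z_i a_j + b_j], where
    [a_j] is the minor without [i]. Hence [r z_i p_r + p_(r-1)] is the sum over [j] of
    [z_i a_j + b_j] times the other [a_l]: the index [i] is kept in exactly one copy. Once all the
    indices are treated, the sum over colorings is left. The delicate point is that an operation in
    [z_i] must not spoil the barrier in [z_j]. The quotient of the [z_j]-derivative by the
    polynomial is, as a function of [z_i], a constant plus simple fractions with real poles and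
    nonnegative residues; for such a quotient the loss is controlled by comparing arithmetic and
    harmonic means of the distances to the roots. Stability lives in the open half-plane and the
    barrier at real points, whence the limits to the boundary. The small diagonal gives the room:
    above [beta] every logarithmic derivative of [det (Z - A)] is at most [1 / kappa], for any
    [kappa] below [beta - delta beta / (beta - 1)]. *)

Definition upd (I : eqType) (X : Type) (f : I -> X) (i : I) (x : X) : I -> X :=
  fun k => if k == i then x else f k.

Lemma upd_same (I : eqType) X (f : I -> X) i x : upd f i x i = x.
Proof. by rewrite /upd eqxx. Qed.

Lemma upd_neq (I : eqType) X (f : I -> X) i x k : k != i -> upd f i x k = f k.
Proof. by rewrite /upd => /negPf ->. Qed.

Lemma upd_upd (I : eqType) (Y : Type) (f : I -> Y) i x y :
  upd (upd f i x) i y =1 upd f i y.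
Proof. by move=> k; rewrite /upd; case: eqP. Qed.

Section PrincipalMinors.
Variables (K : comNzRingType) (n : nat).
Implicit Types (A : 'M[K]_n) (z : 'I_n -> K) (S : {set 'I_n}).

(* The complement of [S] is filled with an identity block, so that all the
   principal minors are determinants of the same size. *)
Definition mask_mx A z S : 'M[K]_n :=
  \matrix_(i, j) if (i \in S) && (j \in S) then z i *+ (i == j) - A i j
                 else (i == j)%:R.

Definition pminor A z S := \det (mask_mx A z S).

Lemma eq_pminor A z z' S : {in S, z =1 z'} -> pminor A z S = pminor A z' S.
Proof.
move=> eq_z; congr (\det _); apply/matrixP => i j; rewrite !mxE.
by case: ifP => // /andP[iS _]; rewrite eq_z.
Qed.

(** Row [i] of the masked matrix is [z i] times a basis vector plus the same row taken at [z i = 0],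
    and the determinant is linear in that row. *)
Lemma pminor_affine A z S i : i \in S ->
  pminor A z S = z i * pminor A z (S :\ i) + pminor A (upd z i 0) S.
Proof.
move=> iS.
(* [B] keeps column [i] unmasked; expanding along row [i] removes that column from the only
   surviving cofactor. *)
pose B := \matrix_(k, j) if k == i then (i == j)%:R else mask_mx A z S k j.
have -> : pminor A z (S :\ i) = \det B.
  rewrite /pminor (expand_det_row _ i) [RHS](expand_det_row _ i).
  apply: eq_bigr => j _; rewrite !mxE !in_setD1 !eqxx /=.
  case: (eqVneq i j) => [<-|]; rewrite ?mul0r // !mul1r.
  rewrite /cofactor; congr (_ * \det _); apply/matrixP => k l.
  by rewrite !mxE !in_setD1 ![lift i _ == i]eq_sym !neq_lift eq_liftF.
rewrite -[X in _ + X]mul1r /pminor; apply: (determinant_multilinear (i0 := i)).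
- apply/rowP => j; rewrite !mxE !eqxx iS /= upd_same mul1r.
  case: ifP => [_|jS]; first by rewrite mul0rn mulr_natr sub0r.
  have -> : (i == j) = false by apply/negP => /eqP ij; rewrite -ij iS in jS.
  by rewrite mulr0 addr0.
- by apply/matrixP => k j; rewrite !mxE eq_sym (negPf (neq_lift _ _)).
- apply/matrixP => k j; rewrite !mxE upd_neq //.
  by rewrite eq_sym neq_lift.
Qed.

End PrincipalMinors.

Lemma rmorph_pminor (K L : comNzRingType) (phi : {rmorphism K -> L}) n
    (A : 'M[K]_n) z S :
  phi (pminor A z S) = pminor (map_mx phi A) (phi \o z) S.
Proof.
rewrite /pminor -det_map_mx; congr (\det _); apply/matrixP => i j; rewrite !mxE.
by case: ifP => _; rewrite ?rmorph_nat // rmorphB rmorphMn.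
Qed.

Section AffineProducts.
Variables (K : comNzRingType) (J : eqType) (a b : J -> K).

Definition aff_poly j : {poly K} := a j *: 'X + (b j)%:P.

Lemma horner_aff_poly j t : (aff_poly j).[t] = t * a j + b j.
Proof. by rewrite !hornerE mulrC. Qed.

Lemma deriv_aff_poly j : (aff_poly j)^`() = (a j)%:P.
Proof. by rewrite derivD derivZ derivX derivC addr0 alg_polyC. Qed.

Lemma size_prod_aff s : (size (\prod_(j <- s) aff_poly j)%R <= (size s).+1)%N.
Proof.
elim: s => [|x s IH]; first by rewrite big_nil size_poly1.
rewrite big_cons; apply: leq_trans (size_polyMleq _ _) _.
have : (size (aff_poly x) <= 2)%N.
  apply: leq_trans (size_polyD _ _) _; rewrite geq_max.
  rewrite (leq_trans (size_scale_leq _ _)) ?size_polyX //.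
  by rewrite (leq_trans (size_polyC_leq1 _)).
by move: IH => /= *; lia.
Qed.

Lemma coef_aff_mul j (p : {poly K}) k :
  (aff_poly j * p)`_k.+1 = a j * p`_k + b j * p`_k.+1.
Proof. by rewrite mulrDl coefD -scalerAl coefZ coefXM /= coefCM. Qed.

Lemma coef_prod_aff s :
  (\prod_(j <- s) aff_poly j)`_(size s) = \prod_(j <- s) a j.
Proof.
elim: s => [|x s IH]; first by rewrite !big_nil coef1.
rewrite !big_cons coef_aff_mul IH.
by rewrite [X in _ + _ * X]nth_default ?mulr0 ?addr0 // size_prod_aff.
Qed.

(** The distinguished factor is recognized by its label, so the head must not occur again in the
    tail. *)
Lemma sum_prod_choice_cons (u v : J -> K) x s : x \notin s ->
  \sum_(j <- x :: s) \prod_(l <- x :: s) (if l == j then u l else v l) =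
  u x * \prod_(l <- s) v l
   + v x * \sum_(j <- s) \prod_(l <- s) (if l == j then u l else v l).
Proof.
move=> xs; rewrite big_cons; congr (_ + _).
  rewrite big_cons eqxx; congr (_ * _).
  rewrite big_seq [RHS]big_seq; apply: eq_bigr => l ls.
  by case: eqP => // lx; rewrite -lx ls in xs.
rewrite mulr_sumr big_seq [RHS]big_seq; apply: eq_bigr => j js.
rewrite big_cons; case: eqP => // xj; by rewrite xj js in xs.
Qed.

Lemma coef_prod_aff_pred s : uniq s -> (0 < size s)%N ->
  (\prod_(j <- s) aff_poly j)`_(size s).-1 =
  \sum_(j <- s) \prod_(l <- s) (if l == j then b l else a l).
Proof.
elim: s => // x s IH /=/andP[xs us] _.
rewrite sum_prod_choice_cons // big_cons.
case: s xs us IH => [|y s] xs us IH.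
  by rewrite !big_nil !mulr1 mulr0 addr0 /= !(coefD, coefZ, coefX, coefC) /= mulr0 add0r.
by rewrite -(IH us) // [size _]/= coef_aff_mul -(coef_prod_aff (y :: s)) addrC.
Qed.

Lemma deriv_prod_aff s t : uniq s ->
  (\prod_(j <- s) aff_poly j)^`().[t] =
  \sum_(j <- s) \prod_(l <- s) (if l == j then a l else t * a l + b l).
Proof.
elim: s => [|x s IH] /=; first by rewrite !big_nil derivC horner0.
case/andP => xs us; rewrite sum_prod_choice_cons // big_cons derivM hornerD.
rewrite !hornerM IH // horner_aff_poly deriv_aff_poly hornerC; congr (_ * _ + _).
by rewrite horner_prod; apply: eq_bigr => l _; rewrite horner_aff_poly.
Qed.

(** This identity turns the operation on the two top coefficients into the choice of one copy: by
    [coef_prod_aff] and [coef_prod_aff_pred], the right-hand side is built from the coefficients of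
    the product of the affine factors. *)
Lemma sum_prod_aff_one s t : uniq s ->
  \sum_(j <- s) \prod_(l <- s) (if l == j then t * a l + b l else a l) =
  (size s)%:R * t * \prod_(l <- s) a l
  + \sum_(j <- s) \prod_(l <- s) (if l == j then b l else a l).
Proof.
elim: s => [|x s IH] /=; first by rewrite !big_nil !mul0r add0r.
case/andP => xs us; rewrite !sum_prod_choice_cons // IH // big_cons.
rewrite -[(size s).+1]addn1 natrD; set P := \prod_(_ <- _) _.
set Q := \sum_(_ <- _) _.
ring.
Qed.

End AffineProducts.

(** * Sums of products of principal minors over families of copies *)

Section Mixed.
Variables (K : comNzRingType) (n : nat) (J : finType).
Implicit Types (A : 'M[K]_n) (z : 'I_n -> K) (W : 'I_n -> {set {set J}})
  (T : {ffun 'I_n -> {set J}}) (i : 'I_n).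

Definition copy T (j : J) : {set 'I_n} := [set i | j \in T i].

(* [T i] is the set of copies of [A] whose selected principal submatrix contains
   the index [i]; [W i] is the set of the values allowed for [T i]. *)
Definition mixed W A z : K :=
  \sum_(T : {ffun 'I_n -> {set J}} | [forall i, T i \in W i])
    \prod_(j : J) pminor A z (copy T j).

Definition ones : {set {set J}} := [set [set j] | j in J].
(** Removing an index from one copy at a time is the product rule, so this family encodes a partial
    derivative, just as [ones] encodes the choice of a color. *)
Definition all_but_ones : {set {set J}} := [set ~: [set j] | j in J].

Lemma mixed_split W i (V : {set {set J}}) A z :
  mixed (upd W i V) A z = \sum_(X in V) mixed (upd W i [set X]) A z.
Proof.
rewrite /mixed (partition_big (fun T : {ffun _ -> _} => T i) (mem V)) /=; last first.
  by move=> T /forallP/(_ i); rewrite upd_same.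
apply: eq_bigr => X XV; apply: eq_bigl => T.
apply/andP/forallP => [[/forallP TW /eqP TX] k|TW].
  have := TW k; rewrite /upd; case: eqP => [->|//] _; by rewrite TX set11.
have TX : T i = X by move: (TW i); rewrite upd_same => /set1P.
split; last by rewrite TX.
apply/forallP => k; have := TW k; rewrite /upd; case: eqP => [->|//] _.
by rewrite TX.
Qed.

Definition ffupd T i X : {ffun 'I_n -> {set J}} := [ffun k => upd T i X k].

(** Reindexing by the families with [T i] empty makes all the copies avoid [i]; the dependence on
    [z i] is then explicit and affine in each copy. *)
Lemma mixed_single W i X A z :
  mixed (upd W i [set X]) A z =
  \sum_(T : {ffun 'I_n -> {set J}} | [forall k, T k \in upd W i [set set0] k])
    \prod_(j : J) (if j \in X then z i * pminor A z (copy T j)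
                     + pminor A (upd z i 0) (i |: copy T j)
                   else pminor A z (copy T j)).
Proof.
rewrite /mixed (reindex_onto (fun T => ffupd T i X) (fun T => ffupd T i set0)) /=; last first.
  move=> T /forallP/(_ i); rewrite upd_same => /set1P TX.
  by apply/ffunP => k; rewrite !ffunE /upd ffunE /upd; case: eqP => [->|].
apply: eq_big => [T|T /andP[_ /eqP TE]].
  apply/andP/forallP => [[/forallP TW /eqP TE] k|TW].
    have := TW k; rewrite !ffunE /upd; case: eqP => [-> _|//].
    by rewrite -TE ffunE upd_same set11.
  split.
    apply/forallP => k; have := TW k; rewrite !ffunE /upd; case: eqP => // _ _.
    exact: set11.
  apply/eqP/ffunP => k; rewrite !ffunE /upd; have := TW k; rewrite ffunE /upd.
  by case: eqP => // _ /set1P.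
have Ti0 : T i = set0 by rewrite -TE ffunE upd_same.
have iT j : i \notin copy T j by rewrite inE Ti0 inE.
have copyE j : copy (ffupd T i X) j = if j \in X then i |: copy T j else copy T j.
  apply/setP => k; rewrite inE ffunE /upd; case: eqP => [->|/eqP ki].
    case: ifP => jX; rewrite !inE ?eqxx // Ti0 inE //.
  by case: ifP; rewrite !inE // (negPf ki).
apply: eq_bigr => j _; rewrite copyE; case: ifP => // _.
by rewrite (pminor_affine _ _ (setU11 i _)) setU1K.
Qed.

Lemma pminor_upd A z (i : 'I_n) t (S : {set 'I_n}) :
  i \notin S -> pminor A (upd z i t) S = pminor A z S.
Proof.
by move=> iS; apply: eq_pminor => k kS; rewrite upd_neq //; apply: contra iS => /eqP <-.
Qed.

Lemma mixed_single_upd W i X A z t :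
  mixed (upd W i [set X]) A (upd z i t) =
  \sum_(T : {ffun 'I_n -> {set J}} | [forall k, T k \in upd W i [set set0] k])
    \prod_(j : J) (if j \in X then t * pminor A z (copy T j)
                     + pminor A (upd z i 0) (i |: copy T j)
                   else pminor A z (copy T j)).
Proof.
rewrite mixed_single; apply: eq_bigr => T /forallP/(_ i).
rewrite upd_same => /set1P Ti0; apply: eq_bigr => j _.
have iT : i \notin copy T j by rewrite inE Ti0 inE.
rewrite upd_same !(pminor_upd _ _ _ iT); case: ifP => // _; congr (_ + _).
by apply: eq_pminor => k _; rewrite upd_upd.
Qed.

Lemma mixed_ones_upd W i A z t :
  mixed (upd W i ones) A (upd z i t) =
  \sum_(T : {ffun 'I_n -> {set J}} | [forall k, T k \in upd W i [set set0] k])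
   \sum_(j : J) \prod_(l : J) (if l == j then t * pminor A z (copy T l)
                     + pminor A (upd z i 0) (i |: copy T l)
                   else pminor A z (copy T l)).
Proof.
rewrite mixed_split big_imset /=; last by move=> j k _ _ /set1_inj.
rewrite exchange_big /=; apply: eq_bigr => j _; rewrite mixed_single_upd.
by apply: eq_bigr => T _; apply: eq_bigr => l _; rewrite inE.
Qed.

Lemma mixed_all_but_ones_upd W i A z t :
  mixed (upd W i all_but_ones) A (upd z i t) =
  \sum_(T : {ffun 'I_n -> {set J}} | [forall k, T k \in upd W i [set set0] k])
   \sum_(j : J) \prod_(l : J) (if l == j then pminor A z (copy T l)
     else t * pminor A z (copy T l) + pminor A (upd z i 0) (i |: copy T l)).
Proof.
rewrite mixed_split big_imset /=; last by move=> j k _ _ /setC_inj/set1_inj.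
rewrite exchange_big /=; apply: eq_bigr => j _; rewrite mixed_single_upd.
by apply: eq_bigr => T _; apply: eq_bigr => l _; rewrite !inE; case: eqP.
Qed.

Lemma mixed_del_upd W i A z t :
  mixed (upd W i [set set0]) A (upd z i t) = mixed (upd W i [set set0]) A z.
Proof.
rewrite mixed_single_upd mixed_single.
by apply: eq_bigr => T _; apply: eq_bigr => j _; rewrite !inE.
Qed.

Lemma mixed_singleton_affine W i j A z t :
  mixed (upd W i [set [set j]]) A (upd z i t) =
  t * mixed (upd W i [set set0]) A z + mixed (upd W i [set [set j]]) A (upd z i 0).
Proof.
rewrite !mixed_single_upd mixed_single mulr_sumr -big_split /=.
apply: eq_bigr => T _; rewrite !(bigD1 (P := predT) j) //= !inE eqxx mul0r add0r.
rewrite mulrDl mulrA; congr (_ * _ + _ * _); apply: eq_bigr => l /negPf lj;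
  by rewrite !inE lj.
Qed.

(** With [i] in every copy, this is the sum as a polynomial in [z i]. Its leading coefficient, its
    derivative and its two top coefficients give the families [[set set0]], [all_but_ones] and
    [ones] at [i]. *)
Definition mixed_poly W i A z : {poly K} :=
  \sum_(T : {ffun 'I_n -> {set J}} | [forall k, T k \in upd W i [set set0] k])
    \prod_(j <- index_enum J) aff_poly (fun j => pminor A z (copy T j))
      (fun j => pminor A (upd z i 0) (i |: copy T j)) j.

Lemma horner_mixed_poly W i A z t :
  (mixed_poly W i A z).[t] = mixed (upd W i [set setT]) A (upd z i t).
Proof.
rewrite mixed_single_upd horner_sum; apply: eq_bigr => T _.
by rewrite horner_prod; apply: eq_bigr => j _; rewrite inE horner_aff_poly.
Qed.

Lemma size_index_enum : size (index_enum J) = #|J|.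
Proof. by rewrite -[RHS]sum1_card -sum1_size. Qed.

Lemma size_mixed_poly W i A z : (size (mixed_poly W i A z) <= #|J|.+1)%N.
Proof.
rewrite /mixed_poly; apply: (leq_trans (size_sum _ _ _)).
by apply/bigmax_leqP => T _; rewrite -size_index_enum; exact: size_prod_aff.
Qed.

Lemma lead_mixed_poly W i A z :
  (mixed_poly W i A z)`_#|J| = mixed (upd W i [set set0]) A z.
Proof.
rewrite mixed_single coef_sum; apply: eq_bigr => T _.
by rewrite -size_index_enum coef_prod_aff; apply: eq_bigr => j _; rewrite inE.
Qed.

Lemma mixed_ones_coef W i A z t : (0 < #|J|)%N ->
  mixed (upd W i ones) A (upd z i t) =
  #|J|%:R * t * (mixed_poly W i A z)`_#|J| + (mixed_poly W i A z)`_#|J|.-1.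
Proof.
move=> J0; rewrite mixed_ones_upd !coef_sum mulr_sumr -big_split /=.
apply: eq_bigr => T _; rewrite -size_index_enum coef_prod_aff.
rewrite coef_prod_aff_pred ?index_enum_uniq ?size_index_enum //.
by rewrite -size_index_enum -sum_prod_aff_one ?index_enum_uniq.
Qed.

Lemma mixed_all_but_ones_deriv W i A z t :
  mixed (upd W i all_but_ones) A (upd z i t) = (mixed_poly W i A z)^`().[t].
Proof.
rewrite mixed_all_but_ones_upd raddf_sum horner_sum; apply: eq_bigr => T _.
by rewrite deriv_prod_aff ?index_enum_uniq.
Qed.

Lemma eq_mixed W W' A z : W =1 W' -> mixed W A z = mixed W' A z.
Proof.
move=> eqW; apply: eq_bigl => T; apply: eq_forallb => k; by rewrite eqW.
Qed.

Lemma eq_mixedz W A z z' : z =1 z' -> mixed W A z = mixed W A z'.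
Proof.
by move=> eqz; apply: eq_bigr => T _; apply: eq_bigr => j _; apply: eq_pminor => k _.
Qed.

Lemma eq_mixed_poly W W' i A z z' :
  (forall k, k != i -> W k = W' k) -> z =1 z' -> mixed_poly W i A z = mixed_poly W' i A z'.
Proof.
move=> eqW eqz; apply: eq_big => [T|T _].
  by apply: eq_forallb => k; rewrite /upd; case: eqVneq => // /eqW ->.
apply: eq_bigr => j _; congr (_ *: _ + polyC _).
  exact: eq_pminor.
by apply: eq_pminor => k _; rewrite /upd; case: (k == i).
Qed.

End Mixed.

(* Otherwise failing unifications unfold the coefficients down to determinants. *)
Opaque mixed_poly.

Lemma rmorph_mixed (K L : comNzRingType) (phi : {rmorphism K -> L}) n
    (J : finType) (W : 'I_n -> {set {set J}}) (A : 'M[K]_n) z :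
  phi (mixed W A z) = mixed W (map_mx phi A) (phi \o z).
Proof.
rewrite rmorph_sum; apply: eq_bigr => T _; rewrite rmorph_prod.
by apply: eq_bigr => j _; rewrite rmorph_pminor.
Qed.

(** * Polynomials on the real line and in the upper half-plane *)

Local Open Scope complex_scope.

Section RealPolynomials.
Import topology normedtype derive realfun numFieldNormedType.Exports.
Variable R : realType.

(** All the limits to the real boundary are taken along polynomials in one real parameter, so
    continuity of polynomials is enough for them. *)
Lemma poly_ge0_right_limit (p : {poly R}) :
  (forall e, 0 < e -> 0 <= p.[e]) -> 0 <= p.[0].
Proof.
move=> p_ge0; rewrite leNgt; apply/negP => p0.
have [d d0 pd] := poly_cont 0 p (e := - p.[0]) ltac:(by rewrite oppr_gt0).
have /pd : `|d / 2 - 0| < d.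
  by rewrite subr0 ger0_norm ?divr_ge0 ?ltW // ltr_pdivrMr // ltr_pMr // ltr1n.
have := p_ge0 (d / 2) ltac:(by rewrite divr_gt0).
by move=> pd0; rewrite ger0_norm; lra.
Qed.

(** The Wronskian is the numerator of the derivative of [f / g]. *)
Lemma wronskian_ratio_monotone (f g : {poly R}) (a b : R) : a <= b ->
  (forall x, a <= x <= b -> 0 < g.[x]) ->
  (forall x, 0 <= f^`().[x] * g.[x] - f.[x] * g^`().[x]) ->
  f.[a] / g.[a] <= f.[b] / g.[b].
Proof.
move=> ab g_gt0 W.
pose h (x : R) := f.[x] / g.[x].
pose dh (x : R) := (f^`().[x] * g.[x] - f.[x] * g^`().[x]) / g.[x] ^+ 2.
have hD x : x \in `[a, b] -> is_derive x 1 h (dh x).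
  rewrite in_itv /= => /g_gt0 gx.
  have gxN : g.[x] != 0 by rewrite gt_eqF.
  have dV : is_derive x 1 (fun y => (g.[y])^-1) (- g.[x] ^- 2 *: g^`().[x]).
    exact: is_deriveV.
  have dM : is_derive x 1 h (f.[x] *: (- g.[x] ^- 2 *: g^`().[x])
                              + (g.[x])^-1 *: f^`().[x]).
    exact: (@is_deriveM _ _ (horner f) (fun y => (g.[y])^-1) x 1 _ _ _ dV).
  apply: is_derive_eq.
  rewrite /dh /GRing.scale /=; field.
  by [].
have [|x xab E] := @MVT_segment _ h dh a b ab (fun x xab => hD x (subset_itv_oo_cc xab)).
  by apply: derivable_within_continuous => x /hD [].
rewrite -subr_ge0 -[X in 0 <= X]/(h b - h a) E mulr_ge0 ?subr_ge0 //.
by rewrite divr_ge0 // sqr_ge0.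
Qed.

Lemma poly_gt0_preserved (p : {poly R}) (a b x : R) :
  a <= x <= b -> (forall y, a <= y <= b -> p.[y] != 0) ->
  0 < p.[b] -> 0 < p.[x].
Proof.
move=> /andP[ax xb] pN0 pb; rewrite lt_neqAle eq_sym pN0 ?ax ?xb //= leNgt.
apply/negP => px; have [|y yxb] := @poly_ivtoo _ p x b xb.
  by rewrite nmulr_rlt0.
move: yxb; rewrite in_itv /= => /andP[xy yb] /rootP py.
by move: (pN0 y); rewrite py eqxx (le_trans ax (ltW xy)) (ltW yb) => /(_ isT).
Qed.

End RealPolynomials.

Section ComplexPolynomials.
Variable R : realType.
Implicit Types (z t w : R[i]) (p q : {poly R[i]}).

Notation re := (@complex.Re R).
Notation im := (@complex.Im R).

(** The squared modulus takes its values in the ordered field [R] and, unlike the modulus, stays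
    polynomial along a real line. *)
Definition nsq z : R := re z ^+ 2 + im z ^+ 2.

Lemma nsq_ge0 z : 0 <= nsq z.
Proof. by rewrite addr_ge0 ?sqr_ge0. Qed.

Lemma nsq_eq0 z : (nsq z == 0) = (z == 0).
Proof.
by case: z => a b; rewrite /nsq /= paddr_eq0 ?sqr_ge0 // !sqrf_eq0 eq_complex.
Qed.

Lemma nsq0 : nsq 0 = 0.
Proof. by apply/eqP; rewrite nsq_eq0. Qed.

Lemma mulc_conj z : z * z^*%C = (nsq z)%:C.
Proof.
case: z => a b; apply/eqP; rewrite /nsq eq_complex /=.
by apply/andP; split; apply/eqP; ring.
Qed.

Lemma im_mulr z (x : R) : im (z * x%:C) = im z * x.
Proof. by case: z => a b /=; ring. Qed.

Lemma re_mulr z (x : R) : re (z * x%:C) = re z * x.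
Proof. by case: z => a b /=; ring. Qed.

Lemma conj_mulr z (x : R) : (z * x%:C)^*%C = z^*%C * x%:C.
Proof. by rewrite rmorphM; congr (_ * _); exact: conjc_real. Qed.

Lemma horner_map_re p (x : R) : (map_poly re p).[x] = re p.[x%:C].
Proof.
elim/poly_ind: p => [|p c IH]; first by rewrite map_poly0 !horner0.
have -> : map_poly re (p * 'X + c%:P) = map_poly re p * 'X + (re c)%:P.
  apply/polyP => k; rewrite coef_map !(coefD, coefMX, coefC) coef_map /= raddfD /=.
  by case: k.
by rewrite !hornerE IH raddfD /= re_mulr.
Qed.

Lemma horner_map_im p (x : R) : (map_poly im p).[x] = im p.[x%:C].
Proof.
elim/poly_ind: p => [|p c IH]; first by rewrite map_poly0 !horner0.
have -> : map_poly im (p * 'X + c%:P) = map_poly im p * 'X + (im c)%:P.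
  apply/polyP => k; rewrite coef_map !(coefD, coefMX, coefC) coef_map /= raddfD /=.
  by case: k.
by rewrite !hornerE IH raddfD /= im_mulr.
Qed.

Lemma horner_conj p (x : R) : (map_poly conjc p).[x%:C] = (p.[x%:C])^*%C.
Proof. by rewrite -{1}[x%:C]conjc_real horner_map. Qed.

(** [im (p * conj q)] has the sign of the imaginary part of [p / q]. It is polynomial in the
    parameter and survives a zero of [q], which is why all the half-plane conditions have this
    form. *)
Lemma im_mulconj_right_limit p q :
  (forall e : R, 0 < e -> im (p.[e%:C] * (q.[e%:C])^*%C) <= 0) ->
  im (p.[0] * (q.[0])^*%C) <= 0.
Proof.
move=> h; rewrite -oppr_ge0.
pose g := - map_poly im (p * map_poly conjc q).
have gE x : g.[x] = - im (p.[x%:C] * (q.[x%:C])^*%C).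
  by rewrite hornerN horner_map_im hornerM horner_conj.
rewrite -[0 in X in _ <= X](_ : (0:R)%:C = 0) // -gE; apply: poly_ge0_right_limit => e e0.
by rewrite gE oppr_ge0 h.
Qed.

Lemma nsqM z w : nsq (z * w) = nsq z * nsq w.
Proof. by case: z w => [a b] [c d]; rewrite /nsq /=; ring. Qed.

Lemma nsq_right_limit p q (c : R) :
  (forall e : R, 0 < e -> c * nsq q.[e%:C] <= nsq p.[e%:C]) ->
  c * nsq q.[0] <= nsq p.[0].
Proof.
move=> h; rewrite -subr_ge0.
pose g := map_poly re (p * map_poly conjc p - c%:C%:P * (q * map_poly conjc q)).
have gE x : g.[x] = nsq p.[x%:C] - c * nsq q.[x%:C].
  rewrite horner_map_re !(hornerM, hornerD, hornerN) !horner_conj hornerC !mulc_conj.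
  by rewrite -rmorphM -rmorphB.
rewrite -[0 in X in _ <= X](_ : (0:R)%:C = 0) // -gE; apply: poly_ge0_right_limit => e e0.
by rewrite gE subr_ge0 h.
Qed.

End ComplexPolynomials.

(** * Partial fractions of a Nevanlinna quotient *)

Section PartialFractions.
Variable R : realType.
Implicit Types (z t w : R[i]) (P Q : {poly R}) (rs : seq R).

Notation re := (@complex.Re R).
Notation im := (@complex.Im R).
Notation toC := (real_complex R).

(** For [m > 1] the [m]-th roots of [xi] sum to zero, and none is real since [xi] is not; so they
    cannot all lie in the lower half-plane. *)
Lemma upper_root_exists (m : nat) (xi : R[i]) : (1 < m)%N -> im xi != 0 ->
  exists2 w, 0 < im w & w ^+ m = xi.
Proof.
move=> m1 xiN.
have m0 : (0 < m)%N by apply: leq_trans m1.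
have [r] := closed_field_poly_normal ('X^m - xi%:P : {poly R[i]}).
rewrite (eqP (monicXnsubC xi m0)) scale1r => rE.
have sr : size r = m.
  by apply: succn_inj; rewrite -(size_prod_XsubC r id) -rE size_XnsubC.
have root_r w : w \in r -> w ^+ m = xi.
  move=> wr; apply/eqP; rewrite -subr_eq0; have : root ('X^m - xi%:P) w.
    by rewrite rE root_prod_XsubC.
  by rewrite rootE !hornerE.
have sum0 : \sum_(w <- r) w = 0.
  apply/eqP; rewrite -oppr_eq0 -coefPn_prod_XsubC ?sr -?lt0n //.
  rewrite -rE coefB coefXn coefC; case: m m1 {m0 rE sr root_r} => [|[|m]] //= _.
  by rewrite (ltn_eqF (leqnn _)) subr0.
have [/hasP[w wr w0]|/hasPn noneP] := boolP (has (fun w => 0 < im w) r).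
  by exists w; rewrite ?root_r.
have neg w : w \in r -> im w < 0.
  move=> wr; rewrite lt_neqAle leNgt noneP // andbT; apply/eqP => im0.
  move: xiN; rewrite -(root_r _ wr) (complexE w) im0 mulr0 addr0 -rmorphXn /=.
  by rewrite eqxx.
have : im (\sum_(w <- r) w) = 0 by rewrite sum0.
case: r {rE root_r sum0 noneP} sr neg => [|x r] sr neg; first by rewrite -sr in m0.
rewrite big_cons raddfD /= raddf_sum /= => E.
have : im x < 0 by apply: neg; rewrite mem_head.
have : \sum_(w <- r) im w <= 0.
  by rewrite big_seq sumr_le0 // => w wr; rewrite ltW // neg // inE wr orbT.
by move: E; lra.
Qed.

Definition xprod rs : {poly R} := \prod_(l <- rs) ('X - l%:P).

(** A rational function that maps the upper half-plane into the closed lower one has simple poles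
    with nonnegative residues. The form without division allows common roots: they are cancelled by
    induction, and when none is left the local behavior at each root of [xprod rs] decides. *)
Lemma partial_fractions rs Q : (size Q <= (size rs).+1)%N ->
  (forall t, 0 < im t ->
     im ((map_poly toC Q).[t] * ((map_poly toC (xprod rs)).[t])^*%C) <= 0) ->
  exists c (s : seq (R * R)), (forall x, x \in s -> 0 <= x.1 /\ x.2 \in rs) /\
    Q = c *: xprod rs + \sum_(x <- s) x.1 *: xprod (rem x.2 rs).
Proof.
elim: {rs}(size rs) {-2}rs (eqP (eqxx (size rs))) Q => [|n IH] rs srs Q sQ imQ.
  move/size0nil: srs sQ imQ => -> /= sQ _; exists Q`_0, [::]; split=> //.
  by rewrite big_nil addr0 /xprod big_nil alg_polyC; exact: size1_polyC.
have [/hasP[l lrs Ql]|/hasPn noroot] := boolP (has (root Q) rs).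
  have [Q1 QE] := factor_theorem Q l Ql.
  have permrs := perm_to_rem lrs.
  have PE : xprod rs = xprod (rem l rs) * ('X - l%:P).
    by rewrite /xprod (perm_big _ permrs) big_cons mulrC.
  have srem : size (rem l rs) = n by rewrite size_rem // srs.
  have sQ1 : (size Q1 <= n.+1)%N.
    have [->|Q10] := eqVneq Q1 0; first by rewrite size_poly0.
    by move: sQ; rewrite QE size_Mmonic ?monicXsubC // size_XsubC addn2 srs ltnS.
  have [|t t0|c [s [sP Q1E]]] := IH _ srem Q1; first by rewrite srem.
    have E (a b : R[i]) : a * (t - l%:C) * (b * (t - l%:C))^*%C
                          = a * b^*%C * (nsq (t - l%:C))%:C.
      rewrite -mulc_conj rmorphM /= -!mulrA; congr (_ * _).
      by rewrite mulrCA.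
    have := imQ t t0; rewrite QE PE.
    rewrite (rmorphM (map_poly toC) Q1) (rmorphM (map_poly toC) (xprod _)) /= !hornerM.
    rewrite rmorphB /= map_polyX map_polyC /= hornerXsubC E.
    rewrite im_mulr pmulr_lle0 // lt_neqAle nsq_ge0 andbT eq_sym nsq_eq0 subr_eq0.
    by apply/eqP => tl; rewrite tl ltxx in t0.
  exists c, s; split=> [x xs|].
    by have [? /mem_rem] := sP x xs.
  rewrite QE Q1E PE mulrDl -scalerAl mulr_suml; congr (_ + _).
  rewrite big_seq [RHS]big_seq; apply: eq_bigr => x /sP[_ xr].
  have p : perm_eq (rem x.2 rs) (l :: rem x.2 (rem l rs)).
    have h1 := perm_to_rem (mem_rem xr); have h2 := perm_to_rem xr.
    rewrite -(perm_cons x.2) -(permPl h1) (permPl permrs).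
    have h3 := perm_catCA [:: x.2] [:: l] (rem x.2 (rem l rs)).
    by rewrite perm_sym h3 perm_cons perm_sym.
  by rewrite -scalerAl /xprod [in RHS](perm_big _ p) big_cons mulrC.
have local mu : mu \in rs -> count_mem mu rs = 1%N /\
    0 <= Q.[mu] * (xprod (rem mu rs)).[mu].
  move=> murs; set m := count_mem mu rs.
  pose P1 : {poly R} := \prod_(l <- rs | l != mu) ('X - l%:P).
  have PE : xprod rs = ('X - mu%:P) ^+ m * P1.
    rewrite /xprod (bigID (pred1 mu)) /=; congr (_ * _).
    rewrite (eq_bigr (fun=> 'X - mu%:P)) => [|l /eqP-> //].
    by rewrite -big_filter big_const_seq count_predT size_filter iter_mulr_1.
  have P1mu : P1.[mu] != 0.
    rewrite horner_prod prodf_seq_neq0; apply/allP => l _; apply/implyP => lmu.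
    by rewrite hornerXsubC subr_eq0 eq_sym.
  have m1 : (0 < m)%N by rewrite -has_count has_pred1.
  (* The sign condition at [mu + e w], as [e] tends to [0+].  For [m > 1] the
     imaginary part of [w ^+ m] takes both signs on the upper half-plane. *)
  have dir w : 0 < im w -> 0 <= Q.[mu] * P1.[mu] * im (w ^+ m).
    move=> w0.
    pose line (p : {poly R}) := map_poly toC p \Po (mu%:C%:P + w *: 'X).
    have lineE p (x : R[i]) : (line p).[x] = (map_poly toC p).[mu%:C + w * x].
      by rewrite horner_comp !hornerE.
    have line0 p : (line p).[0] = p.[mu]%:C by rewrite lineE mulr0 addr0 horner_map.
    have := @im_mulconj_right_limit R (line Q) ((w ^+ m) *: line P1).
    rewrite hornerZ !line0 => h; have {}h := h _.
    have : im (Q.[mu]%:C * (w ^+ m * P1.[mu]%:C)^*%C) <= 0.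
      apply: h => e e0; rewrite hornerZ !lineE.
      have := imQ (mu%:C + w * e%:C).
      rewrite raddfD /= add0r im_mulr mulr_gt0 // => /(_ isT).
      rewrite PE rmorphM rmorphXn rmorphB /= map_polyX map_polyC /= hornerM.
      rewrite horner_exp hornerXsubC [X in X ^+ m]addrAC subrr add0r exprMn.
      rewrite -rmorphXn /= -mulrA [(e ^+ m)%:C * _]mulrC mulrA.
      rewrite conj_mulr mulrA im_mulr.
      by rewrite pmulr_lle0 // exprn_gt0.
    rewrite conj_mulr mulrCA -rmorphM /= im_mulr.
    by case: (w ^+ m) => x y /=; lra.
  have QP1 : Q.[mu] * P1.[mu] != 0 by rewrite mulf_neq0 // -rootE noroot.
  have {m1} m1 : m = 1%N.
    apply/eqP; rewrite eqn_leq m1 andbT leqNgt; apply/negP => m2.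
    have [|w w0 wm] := @upper_root_exists m 'i%C m2; first by rewrite /= oner_eq0.
    have [|v v0 vm] := @upper_root_exists m (- 'i%C) m2; first by rewrite /= oppr_eq0 oner_eq0.
    have := dir _ w0; have := dir _ v0; rewrite wm vm /= mulrN !mulr1 => h1 h2.
    by move/eqP: QP1; apply; apply/eqP; rewrite eq_le h2 -oppr_ge0 h1.
  split=> //; have := dir 'i%C ltr01; rewrite m1 expr1 /= mulr1.
  suff -> : xprod (rem mu rs) = P1 by [].
  apply: (mulfI (negbT (polyXsubC_eq0 mu))).
  by rewrite -[X in X * P1]expr1 -m1 -PE /xprod (perm_big _ (perm_to_rem murs)) big_cons.
have urs : uniq rs.
  by apply: count_mem_uniq => x; case: (boolP (x \in rs)) => [/local[]|/count_memPn].
have rem_neq0 mu : mu \in rs -> (xprod (rem mu rs)).[mu] != 0.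
  by move=> _; rewrite -rootE root_prod_XsubC mem_rem_uniq // !inE eqxx.
(* Lagrange interpolation: the difference of the two sides has degree at most [n] and vanishes at
   the [n.+1] distinct elements of [rs]. *)
exists Q`_n.+1, [seq (Q.[mu] / (xprod (rem mu rs)).[mu], mu) | mu <- rs]; split.
  move=> x /mapP[mu murs ->] /=; split => //; have [_ h] := local mu murs.
  have b0 := rem_neq0 _ murs; have -> : forall a b : R, b != 0 -> a / b = a * b / b ^+ 2.
    by move=> a b bN0; field.
    by rewrite divr_ge0 // sqr_ge0.
  exact: b0.
apply/eqP; rewrite -subr_eq0; apply/eqP; apply: (roots_geq_poly_eq0 _ urs).
  apply/allP => mu murs; rewrite rootE !(hornerE, horner_sum) big_map.
  rewrite (bigD1_seq mu) //= big1_seq => [|nu /andP[nmu nurs]].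
    rewrite !hornerE divfK ?rem_neq0 // [(xprod rs).[mu]](rootP _) ?root_prod_XsubC //.
    by rewrite mulr0 /= add0r addr0 subrr.
  rewrite hornerZ [(xprod _).[mu]](rootP _) ?mulr0 // root_prod_XsubC.
  by rewrite mem_rem_uniq // !inE eq_sym nmu.
apply/leq_sizeP => k; rewrite srs => nk.
rewrite coefB coefD coefZ coef_sum big_map big_seq big1 => [|mu murs]; last first.
  rewrite coefZ nth_default ?mulr0 //.
  by rewrite size_prod_XsubC size_rem // srs.
have [->|kn] := eqVneq k n.+1.
  have -> : (xprod rs)`_n.+1 = 1.
    have /monicP <- : xprod rs \is monic by exact: monic_prod_XsubC.
    by rewrite lead_coefE size_prod_XsubC srs.
  by rewrite mulr1 addr0 subrr.
have nk' : (n.+2 <= k)%N by rewrite ltn_neqAle eq_sym kn nk.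
rewrite [Q`_k]nth_default ?(leq_trans sQ) ?srs //.
by rewrite [(xprod rs)`_k]nth_default ?size_prod_XsubC ?srs // mulr0 addr0 subr0.
Qed.

End PartialFractions.

(** * Stability *)

Section UpperHalfPlane.
Variable R : realType.
Implicit Types (z t w : R[i]) (p : {poly R[i]}).
Notation re := (@complex.Re R).
Notation im := (@complex.Im R).

Lemma split_poly p : p != 0 -> exists rs : seq R[i],
  size p = (size rs).+1 /\ p = lead_coef p *: \prod_(l <- rs) ('X - l%:P).
Proof.
move=> p0; have [rs rsE] := closed_field_poly_normal p; exists rs; split=> //.
by rewrite {1}rsE size_scale ?lead_coef_eq0 // size_prod_XsubC.
Qed.

Lemma stable_roots p (rs : seq R[i]) : p = lead_coef p *: \prod_(l <- rs) ('X - l%:P) ->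
  (forall t, 0 < im t -> p.[t] != 0) -> forall l, l \in rs -> im l <= 0.
Proof.
move=> pE p_neq0 l lrs; rewrite leNgt; apply/negP => /p_neq0.
by rewrite pE hornerZ (rootP (_ : root _ l)) ?mulr0 ?eqxx // root_prod_XsubC.
Qed.

(** The expression is [lead_coef p] times the sum of [t - l] over the roots [l], and each of these
    terms has positive imaginary part. *)
Lemma stable_top_coefs p t (r : nat) : size p = r.+1 -> (0 < r)%N ->
  (forall t, 0 < im t -> p.[t] != 0) -> 0 < im t ->
  r%:R * t * p`_r + p`_r.-1 != 0.
Proof.
move=> sp r0 p_neq0 t0; have p0 : p != 0 by rewrite -size_poly_eq0 sp.
have [rs [srs pE]] := split_poly p0.
have rE : r = size rs by apply: succn_inj; rewrite -sp.
have im_rs := stable_roots pE p_neq0.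
have -> : p`_r = lead_coef p by rewrite lead_coefE sp.
have -> : p`_r.-1 = - (lead_coef p * \sum_(l <- rs) l).
  by rewrite {1}pE coefZ rE coefPn_prod_XsubC -?lt0n -?rE // mulrN.
rewrite mulrC -mulrBr mulf_neq0 ?lead_coef_eq0 //.
apply/eqP => /(congr1 im); rewrite raddfB /= raddf_sum /= => /eqP.
rewrite subr_eq0 mulrC mulr_natr raddfMn /=; apply/negP; rewrite gt_eqF //.
apply: (@le_lt_trans _ _ 0); last by rewrite pmulrn_rgt0.
by rewrite big_seq sumr_le0 // => l /im_rs.
Qed.

(** The logarithmic derivative is the sum of the [1 / (t - l)], each with negative imaginary part;
    the induction clears the denominators. *)
Lemma im_logderiv_prod (rs : seq R[i]) t : (forall l, l \in rs -> im l <= 0) -> 0 < im t ->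
  let p := \prod_(l <- rs) ('X - l%:P) in im (p^`().[t] * p.[t]^*%C) <= 0.
Proof.
move=> im_rs t0; elim: rs im_rs => [|l rs IH] im_rs /=.
  by rewrite big_nil derivC horner0 mul0r.
rewrite big_cons derivM derivXsubC mul1r; set q := \prod_(_ <- _) _.
have {}IH : im (q^`().[t] * q.[t]^*%C) <= 0.
  by apply: IH => l' l'rs; rewrite im_rs // inE l'rs orbT.
have iml : 0 < im (t - l).
  by have := im_rs l (mem_head _ _); rewrite raddfB /= subr_gt0 => /le_lt_trans ->.
rewrite hornerD !hornerM hornerXsubC; move: IH iml.
case: (t - l) => a b; case: q.[t] => c d; case: (q^`().[t]) => e f /= IH b0.
have -> : (c + (a * e - b * f)) * - (a * d + b * c) + (d + (a * f + b * e)) * (a * c - b * d)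
  = - b * (c ^+ 2 + d ^+ 2) + (a ^+ 2 + b ^+ 2) * (e * - d + f * c) by ring.
have h1 : 0 <= b * (c ^+ 2 + d ^+ 2) by rewrite mulr_ge0 ?addr_ge0 ?sqr_ge0 // ltW.
have h2 : (a ^+ 2 + b ^+ 2) * (e * - d + f * c) <= 0.
  by rewrite mulr_ge0_le0 ?addr_ge0 ?sqr_ge0.
by rewrite mulNr; lra.
Qed.

Lemma im_logderiv p t : p != 0 -> (forall t, 0 < im t -> p.[t] != 0) -> 0 < im t ->
  im (p^`().[t] * p.[t]^*%C) <= 0.
Proof.
move=> p0 p_neq0 t0; have [rs [_ pE]] := split_poly p0.
have im_rs := stable_roots pE p_neq0.
have := im_logderiv_prod im_rs t0 => /=; set q := \prod_(_ <- _) _.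
rewrite pE -/q derivZ !hornerZ rmorphM /= => h.
have -> : forall a b c d : R[i], a * b * (c * d) = b * d * (a * c) by move=> *; ring.
by rewrite mulc_conj im_mulr mulr_le0_ge0 // nsq_ge0.
Qed.

End UpperHalfPlane.

(** * Quadratic forms of Hermitian matrices and nonvanishing of minors *)

Section HermitianForms.
Variables (R : realType) (n : nat).
Implicit Types (A : 'M[R[i]]_n) (v z : 'I_n -> R[i]) (S : {set 'I_n}).
Notation re := (@complex.Re R).
Notation im := (@complex.Im R).

Definition hermitian_mx A := forall i j, A i j = (A j i)^*%C.

Definition hform A v : R[i] := \sum_i \sum_j v i * A i j * (v j)^*%C.

Lemma hform_im A v : hermitian_mx A -> im (hform A v) = 0.
Proof.
move=> hA; have : (hform A v)^*%C = hform A v.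
  rewrite /hform rmorph_sum /= exchange_big; apply: eq_bigr => i _.
  rewrite rmorph_sum /=; apply: eq_bigr => j _.
  rewrite !rmorphM /= -hA conjcK; ring.
by case: (hform A v) => x y /= [/eqP]; rewrite -subr_eq0 => /eqP; lra.
Qed.

(** A null vector of the masked matrix vanishes off [S]; pairing it with its conjugate gives the
    displayed equation. Stability and positivity of minors both reduce to excluding such vectors. *)
Lemma pminor_neq0 A z S :
  (forall v, (forall i, i \notin S -> v i = 0) ->
     \sum_i z i * (nsq (v i))%:C = hform A v -> forall i, v i = 0) ->
  pminor A z S != 0.
Proof.
move=> inj; apply/negP => /det0P[u u0 uM].
have uS i : i \notin S -> u 0 i = 0.
  move=> iS; have /rowP/(_ i) := uM; rewrite !mxE (bigD1 i) //= big1 => [|j /negPf ji].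
    by rewrite !mxE (negPf iS) eqxx mulr1 addr0.
  by rewrite !mxE (negPf iS) andbF ji mulr0.
case/eqP: u0; apply/rowP => i; rewrite [RHS]mxE; apply: (inj (u 0)) => //.
apply/eqP; rewrite -subr_eq0 /hform; apply/eqP.
transitivity (\sum_j (u *m mask_mx A z S) 0 j * (u 0 j)^*%C); last first.
  by rewrite uM big1 // => j _; rewrite mxE mul0r.
have -> : \sum_i0 z i0 * (nsq (u 0 i0))%:C =
    \sum_j \sum_i u 0 i * (z i *+ (i == j)) * (u 0 j)^*%C.
  apply: eq_bigr => j _; rewrite (bigD1 j) //= eqxx big1 ?addr0 => [|k /negPf kj].
    by rewrite -mulc_conj mulrA [z j * _]mulrC.
  by rewrite kj mulr0n mulr0 mul0r.
rewrite [X in _ - X]exchange_big -sumrB; apply: eq_bigr => j _.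
rewrite mxE mulr_suml -sumrB; apply: eq_bigr => k _; rewrite mxE.
case: ifP => [_|/negbT]; first by rewrite mulrBr mulrBl.
rewrite negb_and; have [kS /=|/uS-> _] := boolP (k \in S); last by rewrite !mul0r subr0.
by move=> /uS->; rewrite conjc0 !mulr0 subr0.
Qed.

(** On a null vector the form of [A] is real, so the sum of the [im (z i) * nsq (v i)] is zero. *)
Lemma pminor_stable A z S : hermitian_mx A ->
  (forall i, 0 < im (z i)) -> pminor A z S != 0.
Proof.
move=> hA z0; apply: pminor_neq0 => v _ /(congr1 im); rewrite (hform_im _ hA).
rewrite raddf_sum /= => /psumr_eq0P h i; apply/eqP; rewrite -nsq_eq0.
have := h _ i isT; rewrite im_mulr => /(_ _)/eqP; rewrite mulf_eq0 gt_eqF //=; apply.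
by move=> j _; rewrite im_mulr mulr_ge0 ?nsq_ge0 // ltW.
Qed.

Lemma pminor_conj A z S : hermitian_mx A ->
  (pminor A z S)^*%C = pminor A (fun i => (z i)^*%C) S.
Proof.
move=> hA; rewrite rmorph_pminor /pminor -det_tr; congr (\det _).
apply/matrixP => i k; rewrite !mxE.
rewrite andbC eq_sym; case: ifP => // _; congr (_ - _); last exact/esym/hA.
by case: eqP => [->|].
Qed.

Lemma pminor_im0 A (y : 'I_n -> R) S : hermitian_mx A ->
  im (pminor A (fun i => (y i)%:C) S) = 0.
Proof.
move=> hA; have := pminor_conj (fun i => (y i)%:C) S hA.
rewrite (eq_pminor _ (z' := fun i => (y i)%:C)) => [|i _]; last exact: conjc_real.
by case: (pminor _ _ _) => a b /= [/eqP]; rewrite -subr_eq0 => /eqP; lra.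
Qed.

End HermitianForms.

(** * Stability of the sums of products of minors *)

Section Stability.
Variables (R : realType) (n : nat) (J : finType).
Variable A : 'M[R[i]]_n.
Hypothesis hA : hermitian_mx A.
Hypothesis J_gt0 : (0 < #|J|)%N.
Implicit Types (z : 'I_n -> R[i]) (W : 'I_n -> {set {set J}}).
Notation re := (@complex.Re R).
Notation im := (@complex.Im R).

(** These are the families obtained by prescribing the copies of some indices and summing over the
    color of the others; derivatives are left to logarithmic derivative bounds. *)
Definition simple_family W := forall i, (exists X, W i = [set X]) \/ W i = ones J.

Lemma simple_upd W i X : simple_family W -> simple_family (upd W i [set X]).
Proof. by move=> hW k; rewrite /upd; case: eqP => // _; left; exists X. Qed.

(** Each index with [ones] is removed by [stable_top_coefs], applied to the polynomial in its
    variable, which is stable by induction. Without such indices the sum is one product of stable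
    minors. *)
Lemma mixed_stable W z : simple_family W -> (forall i, 0 < im (z i)) ->
  mixed W A z != 0.
Proof.
(* Only indices with a number of choices other than one are counted, so for a single copy [ones]
   falls under the base case. *)
move: {2}#|_|.+1 (ltnSn #|[pred i | #|W i| != 1%N]|) => m.
elim: m W z => // m IH W z Wm sW z0.
have [i iW|all1] := pickP [pred i | #|W i| != 1%N]; last first.
  have WT i : exists X, W i == [set X].
    by have /negbFE/cards1P[X ->] := all1 i; exists X.
  pose T : {ffun 'I_n -> {set J}} := [ffun i => xchoose (WT i)].
  have TE i : W i = [set T i] by rewrite ffunE; exact/eqP/(xchooseP (WT i)).
  rewrite /mixed (big_pred1 T) => [|T' /=].
    by apply/prodf_neq0 => j _; exact: pminor_stable.
  apply/forallP/eqP => [h|-> i]; last by rewrite TE set11.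
  by apply/ffunP => i; have := h i; rewrite TE => /set1P.
have Wi : W i = ones J.
  by case: (sW i) => // -[X WX]; move: iW; rewrite /= WX cards1 eqxx.
have lt_m X : (#|[pred k | #|upd W i [set X] k| != 1%N]| < m)%N.
  move: Wm; rewrite ltnS; apply: leq_trans; apply: proper_card; apply/properP.
  split; last by exists i; rewrite // inE upd_same cards1 eqxx.
  apply/fintype.subsetP => k; rewrite !inE /upd.
  by case: (k == i) => //; rewrite cards1.
have -> : mixed W A z = mixed (upd W i (ones J)) A (upd z i (z i)).
  rewrite (@eq_mixed _ _ _ W (upd W i (ones J))) => [|k]; last first.
    by rewrite /upd; case: eqP => [->|].
  by apply: eq_mixedz => k; rewrite /upd; case: eqP => [->|].
rewrite mixed_ones_coef //; set p := mixed_poly _ _ _ _.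
have pr : p`_#|J| != 0.
  by rewrite lead_mixed_poly; apply: IH => //; exact: simple_upd.
apply: stable_top_coefs => //.
  apply/eqP; rewrite eqn_leq size_mixed_poly /= ltnNge; apply/negP => sp.
  by move: pr; rewrite nth_default ?eqxx.
move=> t t0; rewrite horner_mixed_poly; apply: IH => //; first exact: simple_upd.
by move=> k; rewrite /upd; case: eqP.
Qed.

Lemma mixed_conj W z : (mixed W A z)^*%C = mixed W A (fun i => (z i)^*%C).
Proof.
rewrite rmorph_sum; apply: eq_bigr => T _; rewrite rmorph_prod.
by apply: eq_bigr => j _; exact: pminor_conj.
Qed.

Lemma mixed_im0 W (y : 'I_n -> R) : im (mixed W A (fun i => (y i)%:C)) = 0.
Proof.
have := mixed_conj W (fun i => (y i)%:C).
rewrite (eq_mixedz _ _ (fun i => conjc_real (y i))).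
by case: (mixed _ _ _) => a b /= [/eqP]; rewrite -subr_eq0 => /eqP; lra.
Qed.

End Stability.

(** * The barrier argument *)

Section BarrierShift.
Variable R : realType.
Implicit Types (p q : {poly R}) (rs : seq R) (s t d c mu phi L : R).

(** For [r > 0] and degree at most [r] this is the derivative of order [r - 1] at [t], divided by
    [(r - 1)!]; for a monic [p] of degree [r] it is the sum of the [t - l] over the roots. *)
Definition top2 (r : nat) (t : R) p : R := r%:R * t * p`_r + p`_r.-1.

Lemma top2D r t p q : top2 r t (p + q) = top2 r t p + top2 r t q.
Proof. by rewrite /top2 !coefD; ring. Qed.

Lemma top2Z r t c p : top2 r t (c *: p) = c * top2 r t p.
Proof. by rewrite /top2 !coefZ; ring. Qed.

Lemma top2_sum r t (I : Type) (s : seq I) (f : I -> {poly R}) :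
  top2 r t (\sum_(x <- s) f x) = \sum_(x <- s) top2 r t (f x).
Proof.
elim: s => [|x s IH]; first by rewrite !big_nil /top2 !coef0; ring.
by rewrite !big_cons top2D IH.
Qed.

Lemma size_xprod rs : size (xprod rs) = (size rs).+1.
Proof. exact: size_prod_XsubC. Qed.

Lemma lead_xprod rs : (xprod rs)`_(size rs) = 1.
Proof.
have /monicP <- : xprod rs \is monic by exact: monic_prod_XsubC.
by rewrite lead_coefE size_xprod.
Qed.

Lemma top2_xprod rs s d : (0 < size rs)%N ->
  top2 (size rs) (s - d) (xprod rs) = \sum_(l <- rs) (s - l) - (size rs)%:R * d.
Proof.
move=> rs0; rewrite /top2 lead_xprod coefPn_prod_XsubC -?lt0n // big_split /=.
by rewrite sumrN big_const_seq count_predT iter_addr_0 -mulr_natr; ring.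
Qed.

Lemma top2_xprod_rem rs mu t : mu \in rs -> top2 (size rs) t (xprod (rem mu rs)) = 1.
Proof.
move=> murs; rewrite /top2 nth_default ?size_xprod ?size_rem //; last first.
  by case: rs murs.
by rewrite mulr0 add0r -(size_rem murs) lead_xprod.
Qed.

Lemma horner_xprod rs x : (xprod rs).[x] = \prod_(l <- rs) (x - l).
Proof. by rewrite horner_prod; apply: eq_bigr => l _; rewrite hornerXsubC. Qed.

Lemma xprod_gt0 rs s : (forall l, l \in rs -> l < s) -> 0 < (xprod rs).[s].
Proof.
by move=> h; rewrite horner_xprod big_seq prodr_gt0 // => l /h; rewrite subr_gt0.
Qed.

Lemma horner_xprod_rem rs mu s : mu \in rs -> mu < s ->
  (xprod (rem mu rs)).[s] = (xprod rs).[s] / (s - mu).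
Proof.
move=> murs mus; rewrite !horner_xprod (perm_big _ (perm_to_rem murs)) big_cons /=.
by rewrite mulrC mulKf // subr_eq0 gt_eqF.
Qed.

Lemma deriv_xprod rs s : (forall l, l \in rs -> l < s) ->
  (xprod rs)^`().[s] = (xprod rs).[s] * \sum_(l <- rs) (s - l)^-1.
Proof.
elim: rs => [|x rs IH] h; first by rewrite /xprod !big_nil derivC horner0 mulr0.
rewrite /xprod !big_cons -/(xprod rs) derivM derivXsubC mul1r hornerD !hornerM.
rewrite hornerXsubC IH => [|l lrs]; last by rewrite h // inE lrs orbT.
have : s - x != 0 by rewrite subr_eq0 gt_eqF // h // mem_head.
by move: (\sum_(_ <- _) _) => S x0; field.
Qed.

(* Arithmetic-harmonic mean inequality, obtained by summing the tangent-line
   bound [2 tau - tau^2 / u <= u] at [tau = r.-1 / phi]. *)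
Lemma sum_gaps_rem rs s phi mu : (forall l, l \in rs -> l < s) -> mu \in rs ->
  0 < phi -> \sum_(l <- rs) (s - l)^-1 <= phi ->
  (size rs).-1%:R ^+ 2 / phi <= \sum_(l <- rem mu rs) (s - l).
Proof.
move=> h murs phi0; rewrite (perm_big _ (perm_to_rem murs)) big_cons /= => hphi.
rewrite -(size_rem murs); set ss := rem mu rs in hphi *.
have hss l : l \in ss -> l < s by move/mem_rem/h.
have {}hphi : \sum_(l <- ss) (s - l)^-1 <= phi.
  by apply: le_trans hphi; rewrite lerDr invr_ge0 subr_ge0 ltW // h.
pose tau := (size ss)%:R / phi.
have tangent : \sum_(l <- ss) (2 * tau - tau ^+ 2 * (s - l)^-1) <= \sum_(l <- ss) (s - l).
  rewrite big_seq [leRHS]big_seq; apply: ler_sum => l /hss; rewrite -subr_gt0.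
  move: (s - l) => u u0; rewrite -subr_ge0.
  have -> : u - (2 * tau - tau ^+ 2 * u^-1) = (u - tau) ^+ 2 / u.
    by field; rewrite gt_eqF.
  by rewrite divr_ge0 ?sqr_ge0 // ltW.
apply: le_trans tangent; rewrite sumrB -mulr_sumr -[X in _ - X]mulr_sumr.
rewrite big_const_seq count_predT iter_addr_0.
have h1 : tau ^+ 2 * \sum_(l <- ss) (s - l)^-1 <= tau ^+ 2 * phi.
  by rewrite ler_wpM2l ?sqr_ge0.
have h2 : 2 * (tau *+ size ss) - tau ^+ 2 * phi = (size ss)%:R ^+ 2 / phi.
  by rewrite -mulr_natr /tau; field; rewrite gt_eqF.
by rewrite -h2 lerD2l lerN2.
Qed.

(** Let [D] be [top2] of [xprod rs] at [s - d]. By [sum_gaps_rem] the gaps other than [s - mu] sum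
    to at least [r d], so [s - mu <= D] for each root [mu]. Hence a residue [x.1] is at most
    [D * x.1 / (s - x.2)], and the [top2] of [q] is at most [D] times the value of [q / xprod rs] at
    [s], where the bound by [phi * L] is assumed. *)
Lemma barrier_shift rs s phi d L q c (ss : seq (R * R)) :
  (0 < size rs)%N -> (forall l, l \in rs -> l < s) ->
  0 < phi -> \sum_(l <- rs) (s - l)^-1 <= phi ->
  (size rs)%:R * d <= (size rs).-1%:R ^+ 2 / phi ->
  0 < L ->
  (forall x, x \in ss -> 0 <= x.1 /\ x.2 \in rs) ->
  q = c *: xprod rs + \sum_(x <- ss) x.1 *: xprod (rem x.2 rs) ->
  q.[s] <= phi * (L *: xprod rs).[s] ->
  0 < top2 (size rs) (s - d) (L *: xprod rs) /\
  top2 (size rs) (s - d) q <= phi * top2 (size rs) (s - d) (L *: xprod rs).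
Proof.
move=> rs0 hrs phi0 hphi hd L0 hss qE qs.
set D := top2 (size rs) (s - d) (xprod rs).
have gapD mu : mu \in rs -> s - mu <= D.
  move=> murs; rewrite /D top2_xprod // (perm_big _ (perm_to_rem murs)) big_cons /=.
  by have := sum_gaps_rem hrs murs phi0 hphi; lra.
have D0 : 0 < D.
  have [mu murs] : exists mu, mu \in rs.
    by case: rs rs0 {hrs hphi hd hss qE qs D gapD} => // x rs _; exists x; rewrite mem_head.
  by apply: lt_le_trans (gapD _ murs); rewrite subr_gt0 hrs.
have x0 := xprod_gt0 hrs.
rewrite top2Z mulr_gt0 //; split=> //.
have -> : top2 (size rs) (s - d) q = c * D + \sum_(x <- ss) x.1.
  rewrite qE top2D top2Z top2_sum; congr (_ + _).
  rewrite big_seq [RHS]big_seq; apply: eq_bigr => x /hss[_ xrs].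
  by rewrite top2Z top2_xprod_rem // mulr1.
have sum_le : \sum_(x <- ss) x.1 <= D * \sum_(x <- ss) x.1 / (s - x.2).
  rewrite mulr_sumr big_seq [leRHS]big_seq; apply: ler_sum => x /hss[x1 xrs].
  have xs : 0 < s - x.2 by rewrite subr_gt0 hrs.
  by rewrite mulrA ler_pdivlMr // mulrC ler_wpM2r // gapD.
have : c + \sum_(x <- ss) x.1 / (s - x.2) <= phi * L.
  rewrite -(ler_pM2r x0); apply: (@le_trans _ _ q.[s]); last first.
    by move: qs; rewrite hornerZ mulrA.
  rewrite qE hornerD hornerZ horner_sum mulrDl lerD2l mulr_suml.
  rewrite big_seq [leRHS]big_seq; apply: ler_sum => x /hss[_ xrs].
  by rewrite hornerZ horner_xprod_rem ?hrs // mulrAC mulrA.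
move=> h; have : D * (c + \sum_(x <- ss) x.1 / (s - x.2)) <= D * (phi * L).
  by rewrite ler_pM2l.
rewrite mulrDr [phi * (L * D)]mulrA [phi * L * D]mulrC; apply: le_trans.
by rewrite [c * D]mulrC lerD2l.
Qed.

End BarrierShift.

(** * Restriction to lines and limits at real points *)

Section LinePolynomial.
Variables (K : comNzRingType) (n : nat) (J : finType).
Implicit Types (W : 'I_n -> {set {set J}}) (A : 'M[K]_n) (z w : 'I_n -> K).

(** Evaluating over the polynomial ring makes the dependence on the line parameter polynomial by
    construction. *)
Definition line_poly W A z w : {poly K} :=
  mixed W (map_mx polyC A) (fun k => (z k)%:P + (w k)%:P * 'X).

Lemma horner_line_poly W A z w e :
  (line_poly W A z w).[e] = mixed W A (fun k => z k + w k * e).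
Proof.
rewrite /line_poly -[LHS]/(horner_eval e _) rmorph_mixed.
have -> : map_mx (horner_eval e) (map_mx polyC A) = A.
  by apply/matrixP => i j; rewrite !mxE /= /horner_eval hornerC.
by apply: eq_mixedz => k /=; rewrite /horner_eval !hornerE.
Qed.

End LinePolynomial.

Section RealBoundary.
Variables (R : realType) (n : nat) (J : finType).
Variable A : 'M[R[i]]_n.
Hypothesis hA : hermitian_mx A.
Hypothesis J_gt0 : (0 < #|J|)%N.
Implicit Types (z : 'I_n -> R[i]) (y : 'I_n -> R) (W : 'I_n -> {set {set J}}) (i j : 'I_n).
Notation re := (@complex.Re R).
Notation im := (@complex.Im R).
Notation toC := (real_complex R).

(** Every root lies in the closed lower half-plane, hence at distance at least [im t] from [t]. *)
Lemma nsq_stable_ge (p : {poly R[i]}) t (r : nat) : size p = r.+1 ->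
  (forall t, 0 < im t -> p.[t] != 0) -> 0 < im t ->
  (im t ^+ 2) ^+ r * nsq p`_r <= nsq p.[t].
Proof.
move=> sp p_neq0 t0; have p0 : p != 0 by rewrite -size_poly_eq0 sp.
have [rs [srs pE]] := split_poly p0.
have im_rs := stable_roots pE p_neq0.
have -> : p`_r = lead_coef p by rewrite lead_coefE sp.
have -> : r = size rs by apply: succn_inj; rewrite -sp.
rewrite {2}pE hornerZ nsqM mulrC ler_wpM2l ?nsq_ge0 // horner_prod.
elim: rs im_rs {srs pE} => [|l rs IH] h.
  by rewrite big_nil expr0 /nsq /= expr1n expr0n addr0.
rewrite big_cons nsqM /= [(_ ^+ 2) ^+ _.+1]exprS ler_pM ?exprn_ge0 ?(ltW t0) //; last first.
  by apply: IH => l' l'rs; rewrite h // inE l'rs orbT.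
have := h l (mem_head _ _); rewrite hornerXsubC /nsq !raddfB /= => iml.
by have : 0 <= (re t - re l) ^+ 2 := sqr_ge0 _; nra.
Qed.

Lemma im_shift (a e : R) : im (toC a + 'i%C * toC e) = e.
Proof. by rewrite /=; ring. Qed.

Lemma eq_horner_mixed_poly W i z z' t : z =1 z' ->
  (mixed_poly W i A z).[t] = (mixed_poly W i A z').[t].
Proof.
by move=> zz'; rewrite (eq_mixed_poly A (fun k (_ : k != i) => erefl (W k)) zz').
Qed.

Definition simple_off i W := forall k, k != i -> (exists X, W k = [set X]) \/ W k = ones J.

Lemma simple_off_upd i W X : simple_off i W -> simple_family (upd W i [set X]).
Proof. by move=> h k; rewrite /upd; case: eqVneq => [_|/h//]; left; exists X. Qed.

Notation realpt y := (fun k => toC (y k)).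

Lemma mixed_poly_stable W i z : simple_off i W -> (forall k, 0 < im (z k)) ->
  size (mixed_poly W i A z) = #|J|.+1 /\
  forall t, 0 < im t -> (mixed_poly W i A z).[t] != 0.
Proof.
move=> hW z0; split=> [|t t0].
  apply/eqP; rewrite eqn_leq size_mixed_poly /= ltnNge; apply/negP => sp.
  have := @mixed_stable _ _ _ _ hA J_gt0 (upd W i [set set0]) z (simple_off_upd _ hW) z0.
  by rewrite -lead_mixed_poly nth_default ?eqxx.
rewrite horner_mixed_poly; apply: mixed_stable => //; first exact: simple_off_upd.
by move=> k; rewrite /upd; case: eqP.
Qed.

(* Hurwitz' theorem, from the lower bound [nsq_stable_ge], which survives the
   passage from [y + i e] to [y]. *)
Lemma mixed_poly_real_neq0 W i y t : simple_off i W ->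
  mixed (upd W i [set set0]) A (realpt y) != 0 -> 0 < im t ->
  (mixed_poly W i A (realpt y)).[t] != 0.
Proof.
move=> hW L0 t0.
have [p pE] : exists p : {poly R[i]}, forall e, p.[e] =
    (mixed_poly W i A (fun k => toC (y k) + 'i%C * e)).[t].
  exists (line_poly (upd W i [set setT]) A (upd (realpt y) i t) (upd (fun=> 'i%C) i 0)).
  move=> e; rewrite horner_line_poly horner_mixed_poly.
  by apply: eq_mixedz => k; rewrite /upd; case: (k == i); rewrite ?mul0r ?addr0.
have [q qE] : exists q : {poly R[i]}, forall e, q.[e] =
    mixed (upd W i [set set0]) A (fun k => toC (y k) + 'i%C * e).
  exists (line_poly (upd W i [set set0]) A (realpt y) (fun=> 'i%C)).
  by move=> e; rewrite horner_line_poly.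
have : (im t ^+ 2) ^+ #|J| * nsq q.[0] <= nsq p.[0].
  apply: nsq_right_limit => e e0.
  rewrite pE qE -lead_mixed_poly.
  have [k|sz nz] := mixed_poly_stable hW (z := fun k => toC (y k) + 'i%C * toC e).
    by rewrite im_shift.
  exact: nsq_stable_ge.
have p0 : p.[0] = (mixed_poly W i A (realpt y)).[t].
  by rewrite pE; apply: eq_horner_mixed_poly => k; rewrite mulr0 addr0.
have q0 : q.[0] = mixed (upd W i [set set0]) A (realpt y).
  by rewrite qE; apply: eq_mixedz => k; rewrite mulr0 addr0.
rewrite p0 q0 => {p q pE qE p0 q0}.
move=> h; rewrite -nsq_eq0 gt_eqF //; apply: lt_le_trans h.
by rewrite mulr_gt0 ?exprn_gt0 // lt_neqAle nsq_ge0 eq_sym nsq_eq0 L0.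
Qed.

Lemma upd_comm (I : eqType) X (f : I -> X) (i j : I) a b : i != j ->
  upd (upd f i a) j b =1 upd (upd f j b) i a.
Proof.
move=> ij k; rewrite /upd; case: (eqVneq k j) => [->|] //.
by rewrite eq_sym (negPf ij).
Qed.

Lemma upd_id (I : eqType) X (f : I -> X) (i : I) x : f i = x -> upd f i x =1 f.
Proof. by move=> <- k; rewrite /upd; case: eqP => [->|]. Qed.

(** This is the limit at real coordinates of the sign of a logarithmic derivative: at the points
    [y k + i e] off [i], with [t] in place [i], stability in the variable [z_j] gives the sign by
    [im_logderiv]. *)
Lemma mixed_poly_real_deriv W i j y t : i != j ->
  (forall k, k != i -> k != j -> (exists X, W k = [set X]) \/ W k = ones J) ->
  0 < im t ->
  im ((mixed_poly (upd W j (all_but_ones J)) i A (realpt y)).[t]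
      * ((mixed_poly (upd W j [set setT]) i A (realpt y)).[t])^*%C) <= 0.
Proof.
move=> ij hW t0.
pose V := upd W i [set setT].
have hV : simple_off j V.
  move=> k kj; rewrite /V /upd; case: eqVneq => [_|ki]; first by left; exists setT.
  exact: hW.
pose l X := line_poly (upd V j X) A (upd (realpt y) i t) (upd (fun=> 'i%C) i 0).
have lE X z e : z =1 (fun k => toC (y k) + 'i%C * e) ->
    (l X).[e] = (mixed_poly (upd W j X) i A z).[t].
  move=> zE; rewrite horner_line_poly horner_mixed_poly.
  rewrite (@eq_mixed _ _ _ _ (upd (upd W j X) i [set setT])) => [|k]; last exact: upd_comm.
  apply: eq_mixedz => k; rewrite /upd zE.
  by case: (k == i); rewrite ?mul0r ?addr0.
have lim := @im_mulconj_right_limit R (l (all_but_ones J)) (l [set setT]).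
have z0E : realpt y =1 (fun k => toC (y k) + 'i%C * 0) by move=> k; rewrite mulr0 addr0.
rewrite !(lE _ _ _ z0E) in lim; apply: lim => e e0.
pose z k : R[i] := if k == i then t else toC (y k) + 'i%C * e%:C.
have z0 k : 0 < im (z k).
  by rewrite /z; case: eqP => // _; rewrite im_shift.
have {}lE X : (l X).[e%:C] = mixed (upd V j X) A (upd z j (z j)).
  rewrite horner_line_poly; apply: eq_mixedz => k; rewrite (upd_id erefl) /z /upd.
  by case: (k == i); rewrite ?mul0r ?addr0.
rewrite !lE mixed_all_but_ones_deriv -horner_mixed_poly.
have [sz nz] := mixed_poly_stable hV z0.
by apply: im_logderiv => //; rewrite -size_poly_eq0 sz.
Qed.

End RealBoundary.

(** * One step of the barrier argument *)

Section Barrier.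
Variables (R : realType) (n : nat) (J : finType).
Variable A : 'M[R[i]]_n.
Hypothesis hA : hermitian_mx A.
Hypothesis J_gt0 : (0 < #|J|)%N.
Implicit Types (y : 'I_n -> R) (W : 'I_n -> {set {set J}}) (i j : 'I_n).
Notation re := (@complex.Re R).
Notation im := (@complex.Im R).
Notation toC := (real_complex R).
Notation realpt y := (fun k => toC (y k)).
Notation r := #|J|.

(** The imaginary parts of the coefficients form a real polynomial with more roots than its
    degree. *)
Lemma real_poly_descent (p : {poly R[i]}) : (forall x : R, im p.[toC x] = 0) ->
  exists q : {poly R}, p = map_poly toC q.
Proof.
move=> imp; exists (map_poly re p).
have im0 : map_poly im p = 0.
  apply: (@roots_geq_poly_eq0 _ _ [seq k%:R | k <- iota 0 (size (map_poly im p))]).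
  - by apply/allP => x _; rewrite rootE horner_map_im imp.
  - rewrite map_inj_uniq ?iota_uniq // => a b /eqP; rewrite eqr_nat => /eqP //.
  - by rewrite size_map size_iota.
apply/polyP => k; rewrite !coef_map /=.
have : (map_poly im p)`_k = 0 by rewrite im0 coef0.
by rewrite coef_map /= => h; apply/eqP; rewrite eq_complex /= h !eqxx.
Qed.

(** The roots of a real polynomial are stable under conjugation; with none in the upper half-plane,
    all are real. *)
Lemma xprod_descent (p : {poly R}) : p != 0 ->
  (forall t, 0 < im t -> (map_poly toC p).[t] != 0) ->
  exists rs, p = lead_coef p *: xprod rs.
Proof.
move=> p0 p_neq0; have P0 : map_poly toC p != 0 by rewrite map_poly_eq0.
have [rs [_ PE]] := split_poly P0.
have im_rs := stable_roots PE p_neq0.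
have real_rs l : l \in rs -> toC (re l) = l.
  move=> lrs; suff : im l = 0 by case: (l) => a b /= ->.
  apply/eqP; rewrite eq_le im_rs //= -oppr_le0.
  have imc : im (l^*%C) = - im l by case: (l).
  rewrite -imc leNgt; apply/negP => /p_neq0.
  rewrite -rootE -complex_root_conj => /negP; apply.
  have -> : map_poly conjc (map_poly toC p) = map_poly toC p.
    by apply/polyP => k; rewrite !coef_map /= oppr0.
  by rewrite PE rootZ ?lead_coef_eq0 // root_prod_XsubC.
exists [seq re l | l <- rs]; apply: (map_poly_inj toC).
rewrite {1}PE map_polyZ /= lead_coef_map /=; congr (_ *: _).
rewrite /xprod rmorph_prod /= big_map big_seq [RHS]big_seq; apply: eq_bigr => l lrs.
by rewrite rmorphB /= map_polyX map_polyC /= real_rs.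
Qed.

Definition rmixed W y : R := re (mixed W A (realpt y)).

Lemma rmixedE W y : mixed W A (realpt y) = toC (rmixed W y).
Proof.
have := mixed_im0 hA W y; rewrite /rmixed.
by case: (mixed _ _ _) => a b /= ->.
Qed.

Lemma eq_rmixed W W' y y' : W =1 W' -> y =1 y' -> rmixed W y = rmixed W' y'.
Proof.
move=> eW ey; have ez : realpt y =1 realpt y' by move=> k; rewrite ey.
by rewrite /rmixed (eq_mixed _ _ eW) (eq_mixedz _ _ ez).
Qed.

Lemma upd_realpt y i x : upd (realpt y) i (toC x) =1 realpt (upd y i x).
Proof. by move=> k; rewrite /upd; case: ifP. Qed.

(** One real polynomial in the variable [i] carries all the families needed at [i], which reduces a
    barrier step to one variable. *)
Lemma rmixed_poly W i y : exists p : {poly R},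
  [/\ mixed_poly W i A (realpt y) = map_poly toC p /\ (size p <= r.+1)%N,
      (forall x, p.[x] = rmixed (upd W i [set setT]) (upd y i x)),
      p`_r = rmixed (upd W i [set set0]) y,
      (forall x, p^`().[x] = rmixed (upd W i (all_but_ones J)) (upd y i x)) &
      (forall x, top2 r x p = rmixed (upd W i (ones J)) (upd y i x))].
Proof.
have mixedE V x : mixed V A (upd (realpt y) i (toC x)) = toC (rmixed V (upd y i x)).
  by rewrite (eq_mixedz _ _ (upd_realpt y i x)) rmixedE.
have [x|p pE] := @real_poly_descent (mixed_poly W i A (realpt y)).
  by rewrite horner_mixed_poly mixedE.
exists p; split=> //.
- by split; rewrite // -(size_map_poly toC) -pE size_mixed_poly.
- by move=> x; apply: complexI; rewrite -horner_map -pE horner_mixed_poly mixedE.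
- by apply: complexI; rewrite -coef_map -pE lead_mixed_poly rmixedE.
- move=> x; apply: complexI; rewrite -mixedE mixed_all_but_ones_deriv pE.
  by rewrite deriv_map horner_map.
- move=> x; apply: complexI; rewrite -mixedE mixed_ones_coef // pE !coef_map /top2 /=.
  by rewrite rmorphD !rmorphM rmorph_nat.
Qed.

(** Here [y] is the point already lowered and [y i + d] the coordinate where the barrier is known.
    Positivity to the right of it puts all the roots in [z_i] below it, and positivity with [i]
    deleted fixes the sign of the leading coefficient. *)
Lemma barrier_step W i y (d phi : R) : simple_off i W -> 0 < phi ->
  r%:R * d <= r.-1%:R ^+ 2 / phi ->
  (forall x, y i + d <= x -> 0 < rmixed (upd W i [set setT]) (upd y i x)) ->
  0 < rmixed (upd W i [set set0]) y ->
  rmixed (upd W i (all_but_ones J)) (upd y i (y i + d))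
    <= phi * rmixed (upd W i [set setT]) (upd y i (y i + d)) ->
  0 < rmixed (upd W i (ones J)) y /\
  forall j, j != i -> W j = [set setT] ->
    rmixed (upd (upd W j (all_but_ones J)) i [set setT]) (upd y i (y i + d))
      <= phi * rmixed (upd W i [set setT]) (upd y i (y i + d)) ->
    rmixed (upd (upd W j (all_but_ones J)) i (ones J)) y
      <= phi * rmixed (upd W i (ones J)) y.
Proof.
move=> hW phi0 hd above lead0 bar; set s := y i + d in above bar *.
have [p [[PE sp] pE plead pD ptop]] := rmixed_poly W i y.
have sp' : size p = r.+1.
  apply/eqP; rewrite eqn_leq sp ltnNge; apply/negP => sp1.
  by move: lead0; rewrite -plead nth_default // ltxx.
have p0 : p != 0 by rewrite -size_poly_eq0 sp'.
have [t t0|rs rsE] := xprod_descent p0.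
  rewrite -PE mixed_poly_real_neq0 // rmixedE -[0](rmorph0 toC).
  by rewrite (inj_eq (@complexI R)) gt_eqF.
have leadE : lead_coef p = p`_r by rewrite lead_coefE sp'.
rewrite leadE plead in rsE; set L := rmixed _ y in lead0 plead rsE.
have srs : size rs = r.
  by apply: succn_inj; rewrite -sp' rsE size_scale ?gt_eqF // size_xprod.
have rs_lt l : l \in rs -> l < s.
  move=> lrs; rewrite ltNge; apply/negP => /above; rewrite -pE rsE hornerZ.
  by rewrite (rootP (_ : root _ l)) ?mulr0 ?ltxx // root_prod_XsubC.
have xp0 := xprod_gt0 rs_lt.
have sum_le : \sum_(l <- rs) (s - l)^-1 <= phi.
  move: bar; rewrite -pD -pE rsE derivZ !hornerZ deriv_xprod // => bar.
  by rewrite -(ler_pM2l (mulr_gt0 lead0 xp0)) -mulrA [leRHS]mulrC.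
have yE V : rmixed V (upd y i (s - d)) = rmixed V y.
  by apply: eq_rmixed => // k; rewrite upd_id // /s addrK.
rewrite -yE -ptop.
have r0 : (0 < size rs)%N by rewrite srs.
have hd' : (size rs)%:R * d <= (size rs).-1%:R ^+ 2 / phi by rewrite srs.
split.
  rewrite -srs rsE.
  (* Positivity alone is the case of the zero numerator. *)
  apply: (barrier_shift (q := 0) (c := 0) (ss := [::]) r0 rs_lt phi0 sum_le hd' lead0 _ _ _).1.
  - by [].
  - by rewrite big_nil scale0r addr0.
  - by rewrite horner0 mulr_ge0 ?ltW // hornerZ mulr_gt0.
move=> j ji Wj barj.
have [q [[QE sq] qE _ _ qtop]] := rmixed_poly (upd W j (all_but_ones J)) i y.
rewrite -yE -qtop.
(* As a function of [z_i], the [z_j]-derivative divided by the polynomial satisfies the half-plane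
   condition, hence has nonnegative residues. *)
have [||c [ss [ssP qss]]] := @partial_fractions R rs q; first by rewrite srs.
  move=> t t0.
  have := @mixed_poly_real_deriv R n J A hA J_gt0 W i j y t.
  rewrite eq_sym => /(_ ji)/(_ _ t0).
  rewrite QE (_ : mixed_poly (upd W j [set setT]) i A _ = map_poly toC p); last first.
    by rewrite -PE; apply: eq_mixed_poly => // k _; rewrite upd_id.
  rewrite rsE map_polyZ /= hornerZ [toC L * _]mulrC conj_mulr mulrA => h.
  have {}h := h (fun k ki _ => hW k ki).
  by rewrite -(pmulr_lle0 _ lead0) -im_mulr.
rewrite -srs rsE; apply: (barrier_shift r0 rs_lt phi0 sum_le hd' lead0 ssP qss _).2.
by rewrite -rsE qE pE.
Qed.

End Barrier.

(** * Positive semidefinite forms *)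

Section Positivity.
Variables (R : realType) (n : nat).
Implicit Types (A : 'M[R[i]]_n) (v w : 'I_n -> R[i]) (y : 'I_n -> R) (S : {set 'I_n}).
Notation re := (@complex.Re R).
Notation im := (@complex.Im R).
Notation toC := (real_complex R).
Notation realpt y := (fun k => toC (y k)).

Lemma hformZ A (s : R) v : hform (toC s *: A) v = toC s * hform A v.
Proof.
rewrite /hform mulr_sumr; apply: eq_bigr => i _; rewrite mulr_sumr.
by apply: eq_bigr => j _; rewrite mxE; ring.
Qed.

Lemma conj_realD (s t : R) (x x' : R[i]) :
  (toC s * x + toC t * x')^*%C = toC s * x^*%C + toC t * x'^*%C.
Proof.
case: x x' => [a b] [a' b']; apply/eqP; rewrite eq_complex /=.
by apply/andP; split; apply/eqP; ring.
Qed.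

Lemma hform_combination A v w : exists c, forall s t : R,
  hform A (fun i => toC s * v i + toC t * w i) =
  toC (s ^+ 2) * hform A v + toC (s * t) * c + toC (t ^+ 2) * hform A w.
Proof.
exists (\sum_i \sum_j (v i * A i j * (w j)^*%C + w i * A i j * (v j)^*%C)) => s t.
rewrite /hform !mulr_sumr -!big_split; apply: eq_bigr => i _ /=.
rewrite !mulr_sumr -!big_split; apply: eq_bigr => j _ /=.
rewrite conj_realD.
rewrite !rmorphXn rmorphM /=.
move: (conjc _) (conjc _) (toC s) (toC t) => a b c d; ring.
Qed.

Lemma re_realM (s : R) (x : R[i]) : re (toC s * x) = s * re x.
Proof. by rewrite mulrC re_mulr mulrC. Qed.

(* Cauchy-Schwarz, weighted by [theta]. *)
Lemma hformD_le A v w (theta : R) : (forall v, 0 <= re (hform A v)) -> 0 < theta ->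
  re (hform A (fun i => v i + w i)) <=
  (1 + theta) * re (hform A v) + (1 + theta^-1) * re (hform A w).
Proof.
move=> psd th0; have [c cE] := hform_combination A v w.
have -> : hform A (fun i => v i + w i) = hform A v + c + hform A w.
  have -> : hform A v + c + hform A w
      = hform A (fun i => toC 1 * v i + toC 1 * w i).
    by rewrite cE expr1n mulr1 !mul1r.
  by apply: eq_bigr => i _; apply: eq_bigr => j _; rewrite !mul1r.
have := psd (fun i => toC theta * v i + toC (-1) * w i).
rewrite cE !raddfD /= !re_realM; move: (re _) (re _) (re _) => z y x h.
rewrite -subr_ge0.
have -> : (1 + theta) * x + (1 + theta^-1) * z - (x + y + z) =
   (theta ^+ 2 * x + theta * -1 * y + (-1) ^+ 2 * z) / theta.
  by field; rewrite gt_eqF.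
by rewrite divr_ge0 // ltW.
Qed.

Lemma pminor_gt0 A y S : hermitian_mx A -> (forall v, 0 <= re (hform A v)) ->
  (forall v, (forall i, i \notin S -> v i = 0) -> (exists i, v i != 0) ->
     re (hform A v) < \sum_i y i * nsq (v i)) ->
  0 < re (pminor A (realpt y) S).
Proof.
move=> hA psd lt_y.
have hermZ s : hermitian_mx (toC s *: A).
  by move=> i j; rewrite !mxE [in RHS]mulrC conj_mulr -hA mulrC.
have y_gt0 i : i \in S -> 0 < y i.
  move=> iS; apply: le_lt_trans (psd (fun k => (k == i)%:R)) _.
  apply: lt_le_trans (lt_y _ _ _) _ => [k kS||].
  - by case: eqP kS => // ->; rewrite iS.
  - by exists i; rewrite eqxx oner_eq0.
  rewrite (bigD1 i) //= eqxx big1 => [|k /negPf ->]; last by rewrite nsq0 mulr0.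
  by rewrite /nsq /= expr1n expr0n /= !addr0 mulr1.
(* The minor does not vanish on the path [(1 - s) A] from [A] to [0]. *)
pose P : {poly R[i]} := pminor ((1 - 'X) *: map_mx polyC A) (fun k => (toC (y k))%:P) S.
have PE s : P.[toC s] = pminor (toC (1 - s) *: A) (realpt y) S.
  rewrite /P -[LHS]/(horner_eval _ _) rmorph_pminor.
  have -> : map_mx (horner_eval (toC s)) ((1 - 'X) *: map_mx polyC A) = toC (1 - s) *: A.
    apply/matrixP => i j; rewrite !mxE /horner_eval !hornerE.
    by rewrite rmorphB rmorph1.
  by apply: eq_pminor => k _ /=; rewrite /horner_eval hornerC.
have [x|p pE] := @real_poly_descent R P.
  by rewrite PE pminor_im0.
have {}PE s : re (pminor (toC (1 - s) *: A) (realpt y) S) = p.[s].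
  by rewrite -PE pE horner_map.
have -> : pminor A (realpt y) S = pminor (toC (1 - 0) *: A) (realpt y) S.
  by rewrite subr0 scale1r.
rewrite PE; apply: (@poly_gt0_preserved R p 0 1); first by rewrite lexx ler01.
  move=> s /andP[s0 s1]; rewrite -PE; apply/negP => /eqP re0.
  have /negP[] : pminor (toC (1 - s) *: A) (realpt y) S != 0; last first.
    by rewrite eq_complex /= re0 (pminor_im0 _ _ (hermZ _)) !eqxx.
  apply: pminor_neq0 => v vS; rewrite hformZ => /(congr1 re).
  rewrite re_realM raddf_sum /= => E i; apply/eqP; apply/negPn/negP => vi.
  have := lt_y v vS (ex_intro _ i vi).
  have -> : \sum_k y k * nsq (v k) = \sum_k re (toC (y k) * toC (nsq (v k))).
    by apply: eq_bigr => k _; rewrite re_realM.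
  rewrite E; have := psd v; nra.
rewrite -PE subrr scale0r /pminor.
have -> : mask_mx 0 (realpt y) S = diag_mx (\row_i if i \in S then toC (y i) else 1).
  apply/matrixP => i j; rewrite !mxE subr0.
  case: eqVneq => [<-|ij]; last by case: ifP.
  by rewrite andbb; case: ifP.
rewrite det_diag (_ : \prod_i _ = toC (\prod_i if i \in S then y i else 1)).
  by rewrite /= prodr_gt0 // => i _; case: ifP => // /y_gt0.
by rewrite rmorph_prod; apply: eq_bigr => i _; rewrite mxE; case: ifP.
Qed.

End Positivity.

(** * The initial barrier, from a small diagonal *)

Section DiagonalGap.
Variables (R : realType) (n : nat).
Variable A : 'M[R[i]]_n.
Hypothesis hA : hermitian_mx A.
Notation re := (@complex.Re R).
Notation toC := (real_complex R).
Notation realpt y := (fun k => toC (y k)).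
Implicit Types (y : 'I_n -> R) (i j : 'I_n) (v w : 'I_n -> R[i]) (S : {set 'I_n}).

Variables (delta beta kappa : R).
Hypothesis psd : forall v, 0 <= re (hform A v).
Hypothesis contr : forall v, re (hform A v) <= \sum_i nsq (v i).
Hypothesis diagA : forall i, re (A i i) <= delta.
Hypothesis beta_gt1 : 1 < beta.
Hypothesis kappa_gt0 : 0 < kappa.
Hypothesis kappa_lt : kappa < beta - delta * (beta / (beta - 1)).

Lemma hform_delta (c : R[i]) j :
  hform A (fun i => if i == j then c else 0) = toC (nsq c) * A j j.
Proof.
rewrite /hform (bigD1 j) //= [X in _ + X]big1 => [|i /negPf ->]; last first.
  by rewrite big1 // => k _; rewrite !mul0r.
rewrite addr0 (bigD1 j) //= eqxx big1 => [|i /negPf ->]; last by rewrite conjc0 mulr0.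
by rewrite addr0 -mulc_conj mulrAC.
Qed.

(** One entry of the scalar matrix [beta] can be lowered by [kappa] while staying above [A].
    Splitting off the coordinate [j] with weight [theta = 1 / (beta - 1)] in [hformD_le] gives the
    factors [beta / (beta - 1)] on the diagonal entry and [beta] on the rest. *)
Lemma hform_gap v j : (exists i, v i != 0) ->
  re (hform A v) < beta * \sum_i nsq (v i) - kappa * nsq (v j).
Proof.
move=> [i0 vi0].
have b1 : 0 < beta - 1 by rewrite subr_gt0.
pose x i := if i == j then v j else 0.
pose w i := if i == j then 0 else v i.
have vE : hform A v = hform A (fun i => x i + w i).
  have E i : v i = x i + w i by rewrite /x /w; case: eqP => [->|]; rewrite ?addr0 ?add0r.
  by apply: eq_bigr => i _; apply: eq_bigr => k _; rewrite -!E.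
have wj : w j = 0 by rewrite /w eqxx.
have sumE : \sum_i nsq (v i) = nsq (v j) + \sum_i nsq (w i).
  rewrite (bigD1 j) //= [in RHS](bigD1 j) //= wj nsq0 add0r; congr (_ + _).
  by apply: eq_bigr => i /negPf ij; rewrite /w ij.
have := contr w; have := psd w; rewrite sumE; set s := \sum_i nsq (w i).
have sum0 : 0 <= s by apply: sumr_ge0 => i _; exact: nsq_ge0.
have le_h : re (hform A v) <=
    delta * (beta / (beta - 1)) * nsq (v j) + beta * re (hform A w).
  rewrite vE; apply: le_trans (@hformD_le _ _ A x w (beta - 1)^-1 psd _) _.
    by rewrite invr_gt0.
  have -> : 1 + (beta - 1)^-1 = beta / (beta - 1) by field; rewrite gt_eqF.
  rewrite invrK [1 + _]addrC subrK lerD2r hform_delta re_realM.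
  have := diagA j; have := nsq_ge0 (v j).
  have : 0 <= beta / (beta - 1) by rewrite divr_ge0 ?ltW // (lt_trans _ beta_gt1).
  move: (beta / _) (nsq _) (re _) => a b c a0 b0 cd; rewrite mulrC.
  have : b * c <= b * delta by rewrite ler_wpM2l.
  by move=> /(ler_wpM2r a0); rewrite [b * delta * a]mulrC mulrA [a * b]mulrC; lra.
have vj0 := nsq_ge0 (v j).
(* When [v j] is nonzero, strictness comes from [kappa_lt]; otherwise it comes from [1 < beta]. *)
have [vj|vj] := eqVneq (v j) 0; last first.
  have {}vj : 0 < nsq (v j) by rewrite lt_neqAle vj0 eq_sym nsq_eq0 vj.
  have kN : kappa * nsq (v j) < (beta - delta * (beta / (beta - 1))) * nsq (v j).
    by rewrite ltr_pM2r.
  move=> _ ws; have {}ws : beta * re (hform A w) <= beta * s.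
    by rewrite ler_pM2l // (lt_trans _ beta_gt1).
  rewrite mulrBl in kN; apply: le_lt_trans le_h _; rewrite [beta * (_ + _)]mulrDr.
  by move: kN ws; move: (beta * s) (_ * re _) (_ * nsq _) (_ * nsq _) (_ * nsq _) => *; lra.
have w0 : 0 < s.
  rewrite /s (bigD1 i0) //= ltr_pwDl ?sumr_ge0 // => [|i _]; last exact: nsq_ge0.
  rewrite /w; case: eqP => [i0j|_]; first by rewrite i0j vj eqxx in vi0.
  by rewrite lt_neqAle nsq_ge0 eq_sym nsq_eq0 vi0.
move: le_h beta_gt1; rewrite vj nsq0 !mulr0 !add0r subr0.
have -> : hform A v = hform A w.
  apply: eq_bigr => i _; apply: eq_bigr => k _.
  have E l : v l = w l by rewrite /w; case: eqP => [->|].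
  by rewrite !E.
by move: s w0 {sumE sum0} (re _) => s s0 h; nra.
Qed.

Lemma beta_sum_le y v : (forall i, beta <= y i) ->
  beta * \sum_i nsq (v i) <= \sum_i y i * nsq (v i).
Proof.
move=> yb; rewrite mulr_sumr; apply: ler_sum => i _.
by rewrite ler_wpM2r ?nsq_ge0.
Qed.

Lemma pminor_above_gt0 y S : (forall i, beta <= y i) -> 0 < re (pminor A (realpt y) S).
Proof.
move=> yb; apply: pminor_gt0 => // v _ v0; have [j _] := v0.
apply: lt_le_trans (hform_gap j v0) _; apply: le_trans (beta_sum_le v yb).
by have := mulr_ge0 (ltW kappa_gt0) (nsq_ge0 (v j)); lra.
Qed.

Lemma pminor_shift_gt0 y j S : (forall i, beta <= y i) ->
  0 < re (pminor A (realpt (upd y j (y j - kappa))) S).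
Proof.
move=> yb; apply: pminor_gt0 => // v _ v0.
apply: lt_le_trans (hform_gap j v0) _.
apply: (@le_trans _ _ (\sum_i y i * nsq (v i) - kappa * nsq (v j))).
  by rewrite lerD2r beta_sum_le.
rewrite (bigD1 j) //= [leRHS](bigD1 j) //= upd_same mulrBl addrAC lerD2l.
by apply: ler_sum => i ij; rewrite upd_neq.
Qed.

(** The minor is affine in [y j] with slope the minor without [j], and it is still positive at
    [y j - kappa]. So its logarithmic derivative is at most [1 / kappa]. *)
Lemma pminor_ratio y j S : (forall i, beta <= y i) -> j \in S ->
  kappa * re (pminor A (realpt y) (S :\ j)) <= re (pminor A (realpt y) S).
Proof.
move=> yb jS; have := pminor_shift_gt0 j S yb.
rewrite (pminor_affine A (realpt y) jS) (pminor_affine A (realpt (upd _ _ _)) jS).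
rewrite (@eq_pminor _ _ A _ (realpt y) (S :\ j)) => [|k]; last first.
  by rewrite in_setD1 => /andP[kj _]; rewrite upd_neq.
rewrite (@eq_pminor _ _ A _ (upd (realpt y) j 0) S) => [|k _]; last first.
  by rewrite /upd; case: (k == j).
have reD (a b : R[i]) : re (a + b) = re a + re b by rewrite raddfD.
rewrite upd_same !reD !re_realM => h; apply/ltW.
by rewrite -subr_gt0 addrAC -mulrBl.
Qed.

End DiagonalGap.

(** * Iteration of the barrier step over all the indices *)

Section BarrierIteration.
Variables (R : realType) (n : nat) (J : finType).
Variable A : 'M[R[i]]_n.
Hypothesis hA : hermitian_mx A.
Hypothesis J_gt0 : (0 < #|J|)%N.
Notation re := (@complex.Re R).
Notation im := (@complex.Im R).
Notation toC := (real_complex R).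
Notation realpt y := (fun k => toC (y k)).
Implicit Types (y : 'I_n -> R) (W : 'I_n -> {set {set J}}) (i j : 'I_n)
  (S E U : {set 'I_n}).

Variables (delta beta kappa : R).
Hypothesis psd : forall v, 0 <= re (hform A v).
Hypothesis contr : forall v, re (hform A v) <= \sum_i nsq (v i).
Hypothesis diagA : forall i, re (A i i) <= delta.
Hypothesis beta_gt1 : 1 < beta.
Hypothesis kappa_gt0 : 0 < kappa.
Hypothesis kappa_lt : kappa < beta - delta * (beta / (beta - 1)).

Lemma mixed_singletons W (T : 'I_n -> {set J}) z : (forall i, W i = [set T i]) ->
  mixed W A z = \prod_(j : J) pminor A z [set i | j \in T i].
Proof.
move=> WT; rewrite /mixed (big_pred1 [ffun i => T i]) => [|T' /=].
  apply: eq_bigr => j _; congr (pminor A z _).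
  by apply/setP => k; rewrite !inE ffunE.
apply/forallP/eqP => [h|-> i]; last by rewrite WT ffunE set11.
by apply/ffunP => i; have := h i; rewrite WT => /set1P ->; rewrite ffunE.
Qed.

Lemma rpminorE y S : pminor A (realpt y) S = toC (re (pminor A (realpt y) S)).
Proof.
have := pminor_im0 y S hA.
by case: (pminor _ _ _) => a b /= ->.
Qed.

Lemma rmixed_singletons W (T : 'I_n -> {set J}) y : (forall i, W i = [set T i]) ->
  rmixed A W y = \prod_(j : J) re (pminor A (realpt y) [set i | j \in T i]).
Proof.
move=> WT; apply: complexI; rewrite -rmixedE // (mixed_singletons _ WT) rmorph_prod.
by apply: eq_bigr => j _; rewrite [LHS]rpminorE.
Qed.

(* Elements of [U] lie in exactly one copy (all choices summed), those of [E]
   in none, and the others in all the copies. *)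
Definition stage U E i : {set {set J}} :=
  if i \in U then ones J else if i \in E then [set set0] else [set setT].

Variable d : R.

Definition corner U i : R := if i \in U then beta - d else beta.

Notation phi := (#|J|%:R / kappa).

(** The set [E] is arbitrary because the step at [i] needs the positivity of the leading
    coefficient, in which [i] is deleted; [y] ranges over the whole orthant above the corner because
    the roots in [z_i] are located by positivity on a ray. *)
Definition barrier_bound U := forall E y, [disjoint U & E] ->
  (forall k, corner U k <= y k) ->
  0 < rmixed A (stage U E) y /\
  forall j, j \notin U -> j \notin E ->
    rmixed A (upd (stage U E) j (all_but_ones J)) y <= phi * rmixed A (stage U E) y.

(** For a pure power of one minor the product rule multiplies the bound [1 / kappa] of
    [pminor_ratio] by the number of copies, which gives [phi]. *)
Lemma barrier_bound0 : barrier_bound set0.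
Proof.
move=> E y _ yb.
have {}yb k : beta <= y k by have := yb k; rewrite /corner inE.
have stE : rmixed A (stage set0 E) y = re (pminor A (realpt y) (~: E)) ^+ #|J|.
  rewrite (@rmixed_singletons _ (fun i => if i \in E then set0 else setT)) => [|i].
    rewrite (eq_bigr (fun=> re (pminor A (realpt y) (~: E)))) => [|j _].
      by rewrite prodr_const.
    apply: (congr1 (fun S => re (pminor A (realpt y) S))).
    by apply/setP => k; rewrite !inE; case: ifP; rewrite inE.
  by rewrite /stage inE; case: ifP.
have m_gt0 : 0 < re (pminor A (realpt y) (~: E)).
  exact: (pminor_above_gt0 hA psd contr diagA beta_gt1 kappa_gt0 kappa_lt).
have pow_gt0 : 0 < rmixed A (stage set0 E) y by rewrite stE exprn_gt0.
split=> // j _ jE; rewrite stE.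
have -> : rmixed A (upd (stage set0 E) j (all_but_ones J)) y =
    #|J|%:R * (re (pminor A (realpt y) (~: E :\ j))
               * re (pminor A (realpt y) (~: E)) ^+ #|J|.-1).
  rewrite {1}/rmixed mixed_split big_imset /=; last by move=> a b _ _ /setC_inj/set1_inj.
  rewrite raddf_sum /= (eq_bigr (fun=> re (pminor A (realpt y) (~: E :\ j))
                                * re (pminor A (realpt y) (~: E)) ^+ #|J|.-1)).
    by rewrite sumr_const mulr_natl.
  move=> l _; rewrite -/(rmixed A _ y).
  rewrite (@rmixed_singletons _
    (upd (fun i => if i \in E then set0 else setT) j (~: [set l]))) => [|i].
    rewrite (bigD1 l isT) /=; congr (_ * _).
      apply: (congr1 (fun S => re (pminor A (realpt y) S))).
      apply/setP => k; rewrite !inE /upd; case: eqP => [->|]; first by rewrite !inE eqxx.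
      by case: ifP; rewrite inE.
    rewrite (eq_bigr (fun=> re (pminor A (realpt y) (~: E)))) => [|a al].
      rewrite prodr_const; congr (_ ^+ _).
      by rewrite -(cardC1 l); apply: eq_card => a; rewrite !inE.
    apply: (congr1 (fun S => re (pminor A (realpt y) S))).
    apply/setP => k; rewrite !inE /upd.
    case: eqP => [->|]; first by rewrite !inE al jE.
    by case: ifP; rewrite inE.
  by rewrite /upd; case: eqP => // _; rewrite /stage inE; case: ifP.
move: m_gt0 (pminor_ratio hA psd contr diagA beta_gt1 kappa_lt yb (j := j) (S := ~: E)).
rewrite inE => m_gt0 /(_ jE); move: m_gt0; move: (re _) (re _) => m' m m0 mm'.
have -> : m ^+ #|J| = m * m ^+ #|J|.-1 by rewrite -exprS prednK.
rewrite -[leRHS]mulrA ler_wpM2l ?ler0n // mulrA ler_wpM2r ?exprn_ge0 ?(ltW m0) //.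
by rewrite mulrC ler_pdivlMr // mulrC.
Qed.

Hypothesis d_le : #|J|%:R * d <= #|J|.-1%:R ^+ 2 / phi.

Lemma barrier_boundU i U : i \notin U -> barrier_bound U -> barrier_bound (i |: U).
Proof.
move=> iU IH E y dis yb.
have iE : i \notin E by have := disjointFr dis (setU11 i U) => ->.
have dis' : [disjoint U & E] by apply: disjointWl dis; exact: subsetUr.
have disi : [disjoint U & i |: E].
  rewrite disjoint_subset; apply/fintype.subsetP => k kU; rewrite !inE negb_or.
  by rewrite (disjointFr dis' kU) andbT; apply: contraNneq iU => <-.
have sub_corner x : y i + d <= x -> forall k, corner U k <= upd y i x k.
  move=> yx k; rewrite /upd; have := yb k; rewrite /corner in_setU1.
  case: eqVneq => [->|] //=; rewrite (negPf iU); lra.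
have [pos bar] := IH E (upd y i (y i + d)) dis' (sub_corner _ (lexx _)).
have stT : upd (stage U E) i [set setT] =1 stage U E.
  by apply: upd_id; rewrite /stage (negPf iU) (negPf iE).
have st0 : upd (stage U E) i [set set0] =1 stage U (i |: E).
  move=> k; rewrite /upd /stage in_setU1; case: eqVneq => //= ->.
  by rewrite (negPf iU).
have st1 : upd (stage U E) i (ones J) =1 stage (i |: U) E.
  by move=> k; rewrite /upd /stage in_setU1; case: eqVneq.
have phi_gt0 : 0 < phi by rewrite divr_gt0 // ltr0n.
have hW : simple_off i (stage U E).
  move=> k _; rewrite /stage; case: ifP => _; [by right|left].
  by case: ifP; [exists set0|exists setT].
have [|||q0 qj] := @barrier_step R n J A hA J_gt0 (stage U E) i y d phi hW phi_gt0 d_le.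
- move=> x yx; rewrite (eq_rmixed A stT (frefl _)).
  exact: (IH E (upd y i x) dis' (sub_corner _ yx)).1.
(* The leading coefficient does not depend on [z_i], so raising this coordinate by [d] to meet the
   old corner is harmless. *)
- have := (IH (i |: E) (upd y i (y i + d)) disi (sub_corner _ (lexx _))).1.
  rewrite -(eq_rmixed A st0 (frefl _)) /rmixed.
  by rewrite -(eq_mixedz _ _ (upd_realpt y i _)) mixed_del_upd.
- by rewrite (eq_rmixed A stT (frefl _)); exact: bar.
rewrite -(eq_rmixed A st1 (frefl y)); split=> // j.
rewrite in_setU1 negb_or => /andP[ji jU] jE.
have stj : stage U E j = [set setT] by rewrite /stage (negPf jU) (negPf jE).
have := qj j ji stj; rewrite (eq_rmixed A stT (frefl _)).
rewrite (@eq_rmixed _ _ _ A (upd (upd (stage U E) j (all_but_ones J)) i [set setT])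
   (upd (stage U E) j (all_but_ones J)) _ _ _ (frefl _)) => [|k]; last first.
  rewrite /upd; case: (eqVneq k i) => [->|//].
  by rewrite eq_sym (negPf ji) -stj /stage (negPf iU) (negPf iE) (negPf jU) (negPf jE).
move=> /(_ (bar j jU jE)).
rewrite (@eq_rmixed _ _ _ A (upd (upd (stage U E) j (all_but_ones J)) i (ones J))
   (upd (stage (i |: U) E) j (all_but_ones J)) y y _ (frefl _)) // => k.
by rewrite (upd_comm _ _ _ ji) /upd -st1.
Qed.

Lemma barrier_bound_all U : barrier_bound U.
Proof.
move: {2}#|U|.+1 (ltnSn #|U|) => m; elim: m U => // m IH U Um.
have [->|[i iU]] := set_0Vmem U; first exact: barrier_bound0.
rewrite -(setD1K iU); apply: barrier_boundU; first by rewrite !inE eqxx.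
by apply: IH; move: Um; rewrite (cardsD1 i) iU.
Qed.

End BarrierIteration.

(** * Choosing the copies one index at a time *)

Section Wronskian.
Variable R : realType.
Implicit Types (f g : {poly R}).
Notation re := (@complex.Re R).
Notation im := (@complex.Im R).
Notation toC := (real_complex R).

Lemma poly_deriv_ge0 (h : {poly R}) : h.[0] = 0 ->
  (forall e, 0 < e -> 0 <= h.[e]) -> 0 <= h^`().[0].
Proof.
move=> /rootP /factor_theorem[h1]; rewrite subr0 => hE h_ge0.
have -> : h^`().[0] = h1.[0] by rewrite hE derivM derivX !hornerE ?mulr0 ?add0r.
apply: poly_ge0_right_limit => e e0; have := h_ge0 e e0.
by rewrite hE hornerMX pmulr_lge0.
Qed.

(** Along [x + i e] the imaginary part of [f * conj g] vanishes at [e = 0], is nonnegative for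
    [e > 0], and has the Wronskian as its derivative at [0]. *)
Lemma wronskian_ge0 f g :
  (forall z, 0 < im z -> 0 <= im ((map_poly toC f).[z] * ((map_poly toC g).[z])^*%C)) ->
  forall x, 0 <= f^`().[x] * g.[x] - f.[x] * g^`().[x].
Proof.
move=> fg x.
pose l (p : {poly R}) : {poly R[i]} := map_poly toC p \Po ((toC x)%:P + 'i%C *: 'X).
have lE p e : (l p).[toC e] = (map_poly toC p).[toC x + 'i%C * toC e].
  by rewrite horner_comp !hornerE.
have l0 p : (l p).[toC 0] = toC p.[x] by rewrite lE mulr0 addr0 horner_map.
have ld p : ((l p)^`()).[toC 0] = 'i%C * toC p^`().[x].
  rewrite deriv_comp hornerM deriv_map derivD derivC add0r derivZ derivX.
  by rewrite hornerZ hornerC mulr1 mulrC; congr (_ * _); exact: l0.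
pose h := map_poly im (l f * map_poly conjc (l g)).
have hE e : h.[e] = im ((l f).[toC e] * ((l g).[toC e])^*%C).
  by rewrite horner_map_im hornerM horner_conj.
have -> : f^`().[x] * g.[x] - f.[x] * g^`().[x] = h^`().[0].
  have -> : h^`().[0] = im ((l f * map_poly conjc (l g))^`()).[toC 0].
    by rewrite rmorph0 !horner_coef0 !coef_deriv coef_map.
  rewrite derivM hornerD !hornerM deriv_map !horner_conj.
  rewrite !ld !l0 /=; ring.
apply: poly_deriv_ge0 => [|e e0]; first by rewrite hE !l0 /=; ring.
by rewrite hE !lE fg // im_shift.
Qed.

End Wronskian.

(** * Interlacing and the greedy choice of colors *)

Section Greedy.
Variables (R : realType) (n : nat) (J : finType).
Variable A : 'M[R[i]]_n.
Hypothesis hA : hermitian_mx A.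
Hypothesis J_gt0 : (0 < #|J|)%N.
Notation re := (@complex.Re R).
Notation im := (@complex.Im R).
Notation toC := (real_complex R).
Implicit Types (W : 'I_n -> {set {set J}}) (i j : 'I_n)
  (S : {set 'I_n}) (x : R).

Definition diag_poly_spec W (p : {poly R}) :=
  (forall z, (map_poly toC p).[z] = mixed W A (fun=> z)) /\
  (forall x, p.[x] = rmixed A W (fun=> x)).

Lemma diag_poly W : exists p : {poly R}, diag_poly_spec W p.
Proof.
have lE z : (line_poly W A (fun=> 0) (fun=> 1)).[z] = mixed W A (fun=> z).
  by rewrite horner_line_poly; apply: eq_mixedz => k; rewrite add0r mul1r.
have [x|p pE] := @real_poly_descent R (line_poly W A (fun=> 0) (fun=> 1)).
  by rewrite lE (mixed_im0 hA W (fun=> x)).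
exists p; split=> [z|x]; first by rewrite -pE lE.
by apply: complexI; rewrite -rmixedE // -lE pE horner_map.
Qed.

(** In [z_i] the first factor is [t g + b], whose zero [- b / g] lies in the closed lower half-plane
    by stability; divided by [g] it is [z] minus that zero. *)
Lemma upper_ratio W i (l : J) z : simple_off i W -> 0 < im z ->
  0 <= im (mixed (upd W i [set [set l]]) A (fun=> z)
            * (mixed (upd W i [set set0]) A (fun=> z))^*%C).
Proof.
move=> hW z0; set g := mixed (upd W i [set set0]) A _.
have g0 : g != 0 by apply: mixed_stable => //; exact: simple_off_upd.
set b := mixed (upd W i [set [set l]]) A (upd (fun=> z) i 0).
have fE t : mixed (upd W i [set [set l]]) A (upd (fun=> z) i t) = t * g + b.
  exact: mixed_singleton_affine.
have t0 : im (- b / g) <= 0.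
  rewrite leNgt; apply/negP => imt.
  have /negP[] : mixed (upd W i [set [set l]]) A (upd (fun=> z) i (- b / g)) != 0.
    apply: mixed_stable => //; first exact: simple_off_upd.
    by move=> k; rewrite /upd; case: (k == i).
  by rewrite fE divfK // addNr.
have -> : mixed (upd W i [set [set l]]) A (fun=> z) = (z - - b / g) * g.
  rewrite mulrBl divfK // opprK -fE.
  by apply: eq_mixedz => k; rewrite upd_id.
rewrite -mulrA mulc_conj im_mulr mulr_ge0 ?nsq_ge0 // raddfB /= subr_ge0.
by rewrite (le_trans t0) ?ltW.
Qed.

Variables (a b : R).
Hypothesis above_gt0 : forall S x, b <= x -> 0 < re (pminor A (fun=> toC x) S).

Lemma rmixed_above_gt0 W x : (forall i, W i != set0) -> b <= x -> 0 < rmixed A W (fun=> x).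
Proof.
move=> W0 bx.
have -> : rmixed A W (fun=> x) = \sum_(T : {ffun 'I_n -> {set J}} | [forall i, T i \in W i])
    \prod_(j : J) re (pminor A (fun=> toC x) (copy T j)).
  apply: complexI; rewrite -rmixedE // rmorph_sum; apply: eq_bigr => T _.
  by rewrite rmorph_prod; apply: eq_bigr => j _; rewrite [LHS](rpminorE hA (fun=> x)).
have WT i : exists X, X \in W i by apply/set0Pn.
pose T : {ffun 'I_n -> {set J}} := [ffun i => xchoose (WT i)].
rewrite (bigD1 T) /=; last by apply/forallP => i; rewrite ffunE; exact: xchooseP.
rewrite ltr_pwDl ?sumr_ge0 ?prodr_gt0 // => [j _|T' _]; first exact: above_gt0.
by apply: prodr_ge0 => j _; rewrite ltW // above_gt0.
Qed.

Lemma ones_neq0 : ones J != set0.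
Proof.
by case/card_gt0P: J_gt0 => l _; apply/set0Pn; exists [set l]; apply/imsetP; exists l.
Qed.

Lemma simple_family_neq0 W i : simple_family W -> W i != set0.
Proof.
move=> /(_ i) [[X ->]|->]; last exact: ones_neq0.
by rewrite -card_gt0 cards1.
Qed.

(** The polynomial [g] with [i] deleted interlaces every [F l]. This enters only through the
    monotonicity of [F l / g], so no root is located: some [F l] is positive at [a], and
    monotonicity keeps it positive to the right. *)
Lemma choose_copy W i : simple_off i W ->
  (forall x, a <= x -> 0 < rmixed A (upd W i (ones J)) (fun=> x)) ->
  exists l : J, forall x, a <= x -> 0 < rmixed A (upd W i [set [set l]]) (fun=> x).
Proof.
move=> hW pos.
have [g [gz gx]] := diag_poly (upd W i [set set0]).
have [F FP] : exists F : J -> {poly R}, forall l, diag_poly_spec (upd W i [set [set l]]) (F l).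
  by apply: (fin_all_exists (fun l => diag_poly (upd W i [set [set l]]))).
have W_ge0 l x : 0 <= (F l)^`().[x] * g.[x] - (F l).[x] * g^`().[x].
  apply: wronskian_ge0 => z z0; rewrite gz (FP l).1; exact: upper_ratio.
pose h := \sum_l F l.
have hx x : h.[x] = rmixed A (upd W i (ones J)) (fun=> x).
  rewrite horner_sum /rmixed mixed_split big_imset /=; last by move=> l m _ _ /set1_inj.
  by rewrite raddf_sum; apply: eq_bigr => l _; rewrite (FP l).2.
have Wh x : 0 <= (- g)^`().[x] * h.[x] - (- g).[x] * h^`().[x].
  have -> : h^`().[x] = \sum_l (F l)^`().[x] by rewrite raddf_sum horner_sum.
  rewrite derivN !hornerN horner_sum !mulNr opprK addrC !mulr_sumr -sumrB.
  by apply: sumr_ge0 => l _; rewrite mulrC [g^`().[x] * _]mulrC.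
(* [g / h] is nonincreasing and positive at [b], hence [0 < g] on [`[a, b]]; then
   each [F l / g] is nondecreasing. *)
have g_gt0 x : a <= x -> 0 < g.[x].
  move=> ax; have [bx|xb] := leP b x.
    rewrite gx rmixed_above_gt0 // => k; apply: simple_family_neq0.
    exact: simple_off_upd.
  have gb : 0 < g.[b].
    rewrite gx rmixed_above_gt0 // => k; apply: simple_family_neq0.
    exact: simple_off_upd.
  have := wronskian_ratio_monotone (ltW xb) _ Wh.
  rewrite !hornerN !mulNr lerN2 => le_gh.
  have hpos (t : R) : x <= t -> 0 < h.[t] by move=> xt; rewrite hx pos // (le_trans ax).
  have {}le_gh : g.[b] / h.[b] <= g.[x] / h.[x].
    by apply: le_gh => y /andP[xy _]; exact: hpos.
  have : 0 < g.[x] / h.[x] by apply: lt_le_trans le_gh; rewrite divr_gt0 // hpos // ltW.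
  by rewrite pmulr_lgt0 // invr_gt0 hpos.
have [l Fl] : exists l, 0 < (F l).[a].
  have [/existsP //|/existsPn no] := boolP [exists l, 0 < (F l).[a]].
  have := pos a (lexx a); rewrite -hx horner_sum ltNge => /negP[].
  by apply: sumr_le0 => l _; rewrite leNgt.
exists l => x ax; rewrite -(FP l).2.
have := wronskian_ratio_monotone ax _ (W_ge0 l) => /(_ _) le_Fg.
have {}le_Fg : (F l).[a] / g.[a] <= (F l).[x] / g.[x].
  by apply: le_Fg => y /andP[ay _]; exact: g_gt0.
have : 0 < (F l).[x] / g.[x] by apply: lt_le_trans le_Fg; rewrite divr_gt0 // g_gt0.
by rewrite pmulr_lgt0 // invr_gt0 g_gt0.
Qed.

Lemma greedy_coloring W :
  (forall i, (exists l, W i = [set [set l]]) \/ W i = ones J) ->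
  (forall x, a <= x -> 0 < rmixed A W (fun=> x)) ->
  exists f : 'I_n -> J, forall x, a <= x ->
    0 < rmixed A (fun i => [set [set f i]]) (fun=> x).
Proof.
move: {2}#|_|.+1 (ltnSn #|[pred i | #|W i| != 1%N]|) => m.
elim: m W => // m IH W Wm sW pos.
have [i iW|all1] := pickP [pred i | #|W i| != 1%N]; last first.
  have Wf i : exists l, W i == [set [set l]].
    case: (sW i) => [[l ->]|Wi]; first by exists l.
    have /negbFE/cards1P[X WX] := all1 i.
    have : X \in ones J by rewrite -Wi WX set11.
    by case/imsetP => l _ XE; exists l; rewrite WX XE.
  exists (fun i => xchoose (Wf i)) => x ax.
  rewrite (@eq_rmixed _ _ _ A _ W _ (fun=> x)) ?pos // => k.
  exact/esym/eqP/(xchooseP (Wf k)).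
have Wi : W i = ones J.
  by case: (sW i) => // -[l WX]; move: iW; rewrite /= WX cards1 eqxx.
have hW : simple_off i W.
  by move=> k _; case: (sW k) => [[l ->]|->]; [left; exists [set l]|right].
have [|l posl] := choose_copy hW.
  by move=> x ax; rewrite (eq_rmixed A (upd_id Wi) (frefl _)) pos.
apply: IH posl.
  move: Wm; rewrite ltnS; apply: leq_trans; apply: proper_card; apply/properP.
  split; last by exists i; rewrite // inE upd_same cards1 eqxx.
  apply/fintype.subsetP => k; rewrite !inE /upd.
  by case: (k == i) => //; rewrite cards1.
by move=> k; rewrite /upd; case: (k == i) => //; left; exists l.
Qed.

End Greedy.

(** * Paving *)

Section SpectralBound.
Import spectral sesquilinear.
Local Open Scope sesquilinear_scope.
Variables (R : realType) (n : nat).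
Implicit Types (A M : 'M[R[i]]_n) (v : 'I_n -> R[i]) (S : {set 'I_n}).
Notation re := (@complex.Re R).
Notation toC := (real_complex R).

Lemma hformE A v : hform A v =
  (\row_i v i *m A *m (\row_i v i) ^t*) 0 0.
Proof.
rewrite mxE /hform exchange_big; apply: eq_bigr => j _ /=.
by rewrite !mxE mulr_suml; apply: eq_bigr => i _; rewrite mxE.
Qed.

Lemma hform_le_spectrum M v (b : R) : hermitian_mx M ->
  (forall (d : R) (u : 'rV_n), u != 0 -> u *m M = toC d *: u -> d <= b) ->
  re (hform M v) <= b * \sum_i nsq (v i).
Proof.
move=> hM eig; pose P := spectralmx M; pose sp := spectral_diag M.
have hermM : M \is hermsymmx.
  apply/is_hermitianmxP; rewrite expr0 scale1r; apply/matrixP => i j.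
  by rewrite !mxE hM.
have ME : M = invmx P *m diag_mx sp *m P.
  exact/orthomx_spectralP/hermitian_normalmx.
have Punit : P \in unitmx := spectral_unit M.
have PV : invmx P = P ^t* := invmx_unitary (spectral_unitarymx M).
have spE k : sp 0 k = toC (re (sp 0 k)).
  by rewrite RRe_real //; have /mxOverP -> := hermitian_spectral_diag_real hermM.
have sp_le k : re (sp 0 k) <= b.
  apply: (eig _ (row k P)).
    apply/eqP => Pk0; have : (row k P *m invmx P) 0 k = 0 by rewrite Pk0 mul0mx mxE.
    by rewrite -row_mul mulmxV // !mxE eqxx => /eqP; rewrite oner_eq0.
  rewrite -spE -row_mul {1}ME !mulmxA mulmxV // mul1mx row_mul row_diag_mx.
  by rewrite -scalemxAl -rowE.
pose u : 'rV_n := \row_i v i; pose w := u *m invmx P.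
have wE : w ^t* = P *m u ^t*.
  by rewrite /w PV trmx_mul map_mxM trmxCK.
have formE (D : 'rV[R[i]]_n) : (w *m diag_mx D *m w ^t*) 0 0
    = \sum_k D 0 k * toC (nsq (w 0 k)).
  rewrite mxE; apply: eq_bigr => k _; rewrite mul_mx_diag !mxE.
  by rewrite mulrAC -mulc_conj mulrC.
(* The form identity with all diagonal entries [1] is Parseval's identity for the unitary change of
   basis. *)
have -> : \sum_i nsq (v i) = \sum_k nsq (w 0 k).
  apply: complexI; rewrite !rmorph_sum /=.
  have := formE (const_mx 1); rewrite diag_const_mx mulmx1 wE mulmxA mulmxKV //.
  under [in RHS]eq_bigr do rewrite mxE mul1r.
  move=> <-; rewrite mxE; apply: eq_bigr => i _.
  by rewrite !mxE -mulc_conj.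
rewrite hformE -/u ME !mulmxA -/w -[w *m _ *m P *m _]mulmxA -wE formE raddf_sum mulr_sumr.
apply: ler_sum => k _ /=; rewrite spE re_realM.
by rewrite ler_wpM2r ?nsq_ge0.
Qed.

(** An eigenvector of the compression of [A] to [S] whose eigenvalue exceeds [b] would be a null
    vector of the masked matrix. *)
Lemma pminor_spectral_bound A v S (b : R) : hermitian_mx A -> 0 < b ->
  (forall x, b <= x -> pminor A (fun=> toC x) S != 0) ->
  (forall i, i \notin S -> v i = 0) ->
  re (hform A v) <= b * \sum_i nsq (v i).
Proof.
move=> hA b0 neq0 vS.
pose M : 'M[R[i]]_n := \matrix_(i, j) if (i \in S) && (j \in S) then A i j else 0.
have hM : hermitian_mx M.
  by move=> i j; rewrite !mxE andbC; case: ifP => // _; rewrite conjc0.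
have -> : hform A v = hform M v.
  apply: eq_bigr => i _; apply: eq_bigr => j _; rewrite mxE.
  have [iS|/vS->] /= := boolP (i \in S); last by rewrite !mul0r.
  by have [//|/vS->] := boolP (j \in S); rewrite conjc0 !mulr0.
apply: hform_le_spectrum => // d u u0 uM; rewrite leNgt; apply/negP => bd.
have /negP[] := neq0 d (ltW bd); apply/det0P; exists u => //.
have uME j : toC d * u 0 j = \sum_i u 0 i * M i j.
  by have /rowP/(_ j) := uM; rewrite !mxE.
(* The compression is zero off [S] and [d > b > 0], so the eigenvector is supported in [S]. *)
have uS j : j \notin S -> u 0 j = 0.
  move=> jS; have := uME j; rewrite big1 => [|i _]; last first.
    by rewrite mxE (negPf jS) andbF mulr0.
  move/eqP; rewrite mulf_eq0 => /orP[|/eqP//].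
  by rewrite -(rmorph0 toC) (inj_eq (@complexI R)) gt_eqF // (lt_trans b0).
apply/rowP => j; rewrite !mxE.
have [jS|jS] := boolP (j \in S).
  transitivity (\sum_i (u 0 i * (toC d *+ (i == j)) - u 0 i * M i j)).
    apply: eq_bigr => i _; rewrite !mxE jS andbT.
    by case: ifP => [_|/negbT/uS->]; rewrite ?mulrBr // !mul0r subr0.
  rewrite sumrB -uME (bigD1 j) //= eqxx big1 => [|i /negPf->]; last by rewrite mulr0.
  by rewrite addr0 mulrC subrr.
rewrite big1 // => i _; rewrite mxE (negPf jS) andbF.
by case: eqP => [->|]; rewrite ?(uS j jS) ?mul0r ?mulr0.
Qed.

End SpectralBound.

(** All coordinates can be lowered from [beta] to [beta - d], and the chosen coloring keeps the
    product of its block minors positive from there on. So no block has an eigenvalue above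
    [beta - d]. *)
Theorem paving (R : realType) (n : nat) (J : finType) (A : 'M[R[i]]_n)
    (delta beta kappa : R) :
  hermitian_mx A -> (0 < #|J|)%N ->
  (forall v, 0 <= complex.Re (hform A v)) ->
  (forall v, complex.Re (hform A v) <= \sum_i nsq (v i)) ->
  (forall i, complex.Re (A i i) <= delta) ->
  1 < beta -> 0 < kappa -> kappa < beta - delta * (beta / (beta - 1)) ->
  0 <= delta ->
  exists f : 'I_n -> J, forall (l : J) (v : 'I_n -> R[i]),
    (forall i, f i != l -> v i = 0) ->
    complex.Re (hform A v) <= (beta - kappa + 2 * kappa / #|J|%:R) * \sum_i nsq (v i).
Proof.
move=> hA J0 psd contr diagA b1 k0 kb delta0.
set r : R := #|J|%:R; have r0 : 0 < r by rewrite ltr0n.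
have r1E : (#|J|.-1%:R : R) = r - 1 by rewrite -subn1 natrB.
(* This is the largest shift allowed for [phi = r / kappa]; the stated bound drops the term
   [kappa / r ^+ 2] of [beta - d]. *)
pose d : R := (r - 1) ^+ 2 * kappa / r ^+ 2.
have dE : r * d <= #|J|.-1%:R ^+ 2 / (r / kappa).
  rewrite r1E le_eqVlt; apply/orP; left; apply/eqP; rewrite /d; field.
  by rewrite !gt_eqF.
have dk : kappa - 2 * kappa / r + kappa / r ^+ 2 = d.
  rewrite /d; field.
  by rewrite gt_eqF.
have r_ge1 : 1 <= r by rewrite ler1n.
have d_le_kappa : d <= kappa.
  rewrite /d ler_pdivrMr ?exprn_gt0 // [leRHS]mulrC ler_wpM2r ?(ltW k0) //.
  by move: r r_ge1 {d dE dk r1E r0} => r r_ge1; nra.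
have bb : 0 <= delta * (beta / (beta - 1)).
  by rewrite mulr_ge0 // divr_ge0 ?subr_ge0 ?ltW // (lt_trans ltr01).
have bd0 : 0 < beta - d by lra.
have bound := barrier_bound_all hA J0 psd contr diagA b1 k0 kb dE.
have above S (x : R) : beta <= x -> 0 < complex.Re (pminor A (fun=> (x)%:C) S).
  move=> bx; exact: (pminor_above_gt0 hA psd contr diagA b1 k0 kb S (y := fun=> x)).
have [||f fP] := @greedy_coloring R n J A hA J0 (beta - d) beta above (fun=> ones J).
- by move=> i; right.
- move=> x bx; have := (bound [set: 'I_n] set0 (fun=> x) _ _).1.
  rewrite (@eq_rmixed _ _ _ A _ (fun=> ones J) _ (fun=> x)) => [|k|//]; last first.
    by rewrite /stage inE.
  apply=> [|k]; last by rewrite /corner inE.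
  by rewrite disjoint_sym disjoints_subset sub0set.
exists f => l v vl.
apply: (@le_trans _ _ ((beta - d) * \sum_i nsq (v i))); last first.
  rewrite ler_wpM2r ?sumr_ge0 // => [i _|]; first exact: nsq_ge0.
  rewrite -dk; have := divr_ge0 (ltW k0) (sqr_ge0 r).
  by move: (2 * kappa / r) (kappa / r ^+ 2) => *; lra.
apply: (@pminor_spectral_bound _ _ A v [set i | f i == l]) => // [x bx|i]; last first.
  by rewrite inE => /vl.
have := fP x bx; rewrite (@rmixed_singletons _ _ _ _ hA _ (fun i => [set f i])) // => pr.
apply/negP => /eqP p0; move: pr; rewrite (bigD1 l) //=.
have -> : [set i | l \in [set f i]] = [set i | f i == l].
  by apply/setP => i; rewrite !inE eq_sym.
by rewrite p0 mul0r ltxx.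
Qed.

(** * Two-sided Riesz bounds *)

Section TwoSidedColoring.
Variables (R : realType) (n : nat).
Implicit Types (G : 'M[R[i]]_n) (v : 'I_n -> R[i]).
Notation re := (@complex.Re R).
Notation toC := (real_complex R).

Lemma upper_coloring G (eps B : R) (r : nat) : hermitian_mx G ->
  (forall v, 0 <= re (hform G v)) ->
  (forall v, re (hform G v) <= B ^+ 2 * \sum_i nsq (v i)) ->
  (forall i, G i i = 1) ->
  0 < eps -> eps < 1 -> 1 < B -> 24 * B ^+ 2 / eps ^+ 2 <= r%:R ->
  exists f : 'I_n -> 'I_r, forall l v, (forall i, f i != l -> v i = 0) ->
    re (hform G v) <= (1 + eps) * \sum_i nsq (v i).
Proof.
move=> hG psd le_B diag e0 e1 B1 rB.
have B0 : 0 < B by lra.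
have B20 : 0 < B ^+ 2 by rewrite exprn_gt0.
have r0 : 0 < r%:R :> R by apply: lt_le_trans rB; rewrite divr_gt0 ?mulr_gt0 ?exprn_gt0.
(* This [beta] makes [beta / (beta - 1)] equal to [1 + eps / 2]. The factor [1 + 3 / 4 * eps] in
   [kappa] satisfies the strict gap condition and leaves [eps / 4] for the error [2 * kappa / r],
   where [kappa <= 3 / eps] explains the constant 24. *)
pose beta := 1 + 2 / eps; pose delta := B ^- 2.
pose kappa := beta - (1 + 3 / 4 * eps) * delta.
have d0 : 0 < delta by rewrite invr_gt0.
have d1 : delta < 1 by rewrite invf_lt1 // exprn_egt1.
have ie : 1 < eps^-1 by rewrite invf_gt1.
have beta3 : 3 < beta by rewrite /beta; lra.
have bb : beta / (beta - 1) = 1 + eps / 2.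
  have -> : beta - 1 = 2 / eps by rewrite /beta; ring.
  by rewrite /beta; field; rewrite ?pnatr_eq0 ?gt_eqF.
have [|||||||||f fP] := @paving R n 'I_r (toC delta *: G) delta beta kappa.
- by move=> i j; rewrite !mxE [in RHS]mulrC conj_mulr -hG mulrC.
- by rewrite card_ord -(ltr0n R).
- by move=> v; rewrite hformZ re_realM mulr_ge0 // ltW.
- by move=> v; rewrite hformZ re_realM /delta mulrC ler_pdivrMr // mulrC.
- by move=> i; rewrite mxE diag mulr1.
- lra.
- by rewrite /kappa; nra.
- by rewrite bb /kappa; nra.
- exact: ltW.
exists f => l v vl; have := fP l v vl.
rewrite hformZ re_realM card_ord.
have -> : beta - kappa = (1 + 3 / 4 * eps) * delta by rewrite /kappa; ring.
have s0 : 0 <= \sum_i nsq (v i) by apply: sumr_ge0 => i _; exact: nsq_ge0.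
move=> h; have {h} : re (hform G v) <=
    B ^+ 2 * ((1 + 3 / 4 * eps) * delta + 2 * kappa / r%:R) * \sum_i nsq (v i).
  by rewrite -[leRHS]mulrA -ler_pdivrMl.
move/le_trans; apply; rewrite ler_wpM2r // mulrDr mulrCA mulfV ?gt_eqF // mulr1.
rewrite -addrA lerD2l.
have kb : kappa <= 3 / eps.
  by rewrite /kappa /beta; nra.
have : B ^+ 2 * (2 * kappa / r%:R) <= eps / 4.
  rewrite mulrA ler_pdivrMr //.
  have : B ^+ 2 * (2 * (3 / eps)) <= eps / 4 * r%:R.
    apply: le_trans (_ : eps / 4 * (24 * B ^+ 2 / eps ^+ 2) <= _).
      rewrite le_eqVlt; apply/orP; left; apply/eqP; field.
      by rewrite gt_eqF.
    by rewrite ler_pM2l // divr_gt0.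
  by apply: le_trans; rewrite ler_pM2l // ler_pM2l.
lra.
Qed.

Definition restrict (J : eqType) (f : 'I_n -> J) (l : J) v : 'I_n -> R[i] :=
  fun i => if f i == l then v i else 0.

(** The block-diagonal part lets one application of [paving] treat all the classes of [f]
    together. *)
Definition blocks (J : eqType) (f : 'I_n -> J) G : 'M[R[i]]_n :=
  \matrix_(i, j) if f i == f j then G i j else 0.

Lemma hform_blocks (J : finType) (f : 'I_n -> J) G v :
  hform (blocks f G) v = \sum_l hform G (restrict f l v).
Proof.
rewrite /hform [RHS]exchange_big; apply: eq_bigr => i _.
rewrite [RHS]exchange_big; apply: eq_bigr => j _ /=.
rewrite [RHS](bigD1 (f i)) //= [X in _ + X]big1 => [|l /negPf li]; last first.
  by rewrite /restrict eq_sym li !mul0r.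
rewrite mxE /restrict eqxx eq_sym addr0; case: ifP => // _.
by rewrite conjc0 !mulr0 mul0r.
Qed.

Lemma sum_restrict (J : finType) (f : 'I_n -> J) v :
  \sum_i nsq (v i) = \sum_l \sum_i nsq (restrict f l v i).
Proof.
rewrite [RHS]exchange_big; apply: eq_bigr => i _ /=.
rewrite (bigD1 (f i)) //= big1 => [|l /negPf li].
  by rewrite /restrict eqxx addr0.
by rewrite /restrict eq_sym li nsq0.
Qed.

Lemma lower_coloring (J : finType) (f : 'I_n -> J) G (eps : R) (r : nat) :
  hermitian_mx G ->
  (forall v, 0 <= re (hform G v)) ->
  (forall l v, (forall i, f i != l -> v i = 0) ->
     re (hform G v) <= (1 + eps) * \sum_i nsq (v i)) ->
  (forall i, G i i = 1) ->
  0 < eps -> eps < 1 -> 48 / eps <= r%:R ->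
  exists g : 'I_n -> 'I_r, forall l m v, (forall i, f i != l -> v i = 0) ->
    (forall i, g i != m -> v i = 0) ->
    (1 - eps) * \sum_i nsq (v i) <= re (hform G v).
Proof.
move=> hG psd le_f diag e0 e1 re0.
have r0 : 0 < r%:R :> R by apply: lt_le_trans re0; rewrite divr_gt0.
(* The diagonal of [1 - c G] is [1 - c = delta]. With [beta = 3] the gap condition reads
   [kappa < 3 - 3 / 2 * delta]; the choice [7 / 4] leaves [delta / 4] for the error term, so the
   blocks are at most [2 * delta]. *)
pose c := (1 + eps)^-1; pose delta := eps * c; pose kappa := 3 - 7 / 4 * delta.
have e10 : 0 < 1 + eps by lra.
have c0 : 0 < c by rewrite invr_gt0.
have cE : c = 1 - delta.
  by rewrite /delta /c; field; rewrite gt_eqF.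
have c_half : 1 / 2 < c by rewrite /c div1r ltf_pV2 ?posrE //; lra.
have d0 : 0 < delta by rewrite mulr_gt0.
pose H : 'M[R[i]]_n := 1%:M - toC c *: G.
have hH : hermitian_mx H.
  move=> i j; rewrite !mxE rmorphB /= eq_sym; congr (_ - _).
    by case: (j == i); rewrite ?conjc1 ?conjc0.
  by rewrite [in RHS]mulrC conj_mulr -hG mulrC.
have hformH v : re (hform H v) = \sum_i nsq (v i) - c * re (hform G v).
  have -> : hform H v = toC (\sum_i nsq (v i)) - toC c * hform G v.
    rewrite rmorph_sum /= -hformZ /hform -sumrB; apply: eq_bigr => i _.
    rewrite -mulc_conj.
    transitivity (\sum_j (v i * (i == j)%:R * (v j)^*%C
       - v i * (toC c *: G) i j * (v j)^*%C)).
      by apply: eq_bigr => j _; rewrite 3!mxE mulrBr mulrBl !mxE.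
    rewrite sumrB; congr (_ - _); rewrite (bigD1 i) //= eqxx mulr1 big1 ?addr0 //.
    by move=> j /negPf ji; rewrite eq_sym ji mulr0 mul0r.
  by rewrite raddfB /= re_realM.
have H_ge0 l v : (forall i, f i != l -> v i = 0) -> 0 <= re (hform H v).
  move=> /le_f; rewrite hformH subr_ge0 -ler_pdivlMl //.
  by rewrite /c invrK.
have restrict0 l v i : f i != l -> restrict f l v i = 0.
  by rewrite /restrict => /negPf ->.
have [|||||||||g gP] := @paving R n 'I_r (blocks f H) delta 3 kappa.
- move=> i j; rewrite [LHS]mxE [X in X^*%C]mxE eq_sym.
  by case: ifP => _; [exact: hH|rewrite conjc0].
- by rewrite card_ord -(ltr0n R).
- move=> v; rewrite hform_blocks raddf_sum; apply: sumr_ge0 => l _.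
  exact/(H_ge0 l)/restrict0.
- move=> v; rewrite hform_blocks raddf_sum (sum_restrict f v); apply: ler_sum => l _ /=.
  by rewrite hformH gerBl mulr_ge0 // ltW.
- by move=> i; rewrite mxE eqxx !mxE diag eqxx mulr1 cE /= opprB addrC subrK.
- lra.
- by rewrite /kappa; lra.
- have -> : (3 : R) / (3 - 1) = 3 / 2 by congr (_ / _); lra.
  by rewrite /kappa; lra.
- exact: ltW.
exists g => l m v vl vm; have := gP m v vm.
have -> : hform (blocks f H) v = hform H v.
  apply: eq_bigr => i _; apply: eq_bigr => j _; rewrite mxE.
  case: ifP => // /negbT fij; have [/vl -> | /negbNE/eqP fi] := boolP (f i != l).
    by rewrite !mul0r.
  by rewrite (vl j) -?fi 1?eq_sym // conjc0 !mulr0.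
rewrite hformH card_ord.
have s0 : 0 <= \sum_i nsq (v i) by apply: sumr_ge0 => i _; exact: nsq_ge0.
have : 3 - kappa + 2 * kappa / r%:R <= 2 * delta.
  have : 2 * kappa / r%:R <= delta / 4.
    rewrite ler_pdivrMr //; apply: le_trans (_ : delta / 4 * (48 / eps) <= _).
      have -> : delta / 4 * (48 / eps) = 12 * c by rewrite /delta; field; rewrite gt_eqF.
      by rewrite /kappa; lra.
    by rewrite ler_pM2l // divr_gt0.
  by rewrite /kappa; lra.
move=> /(ler_wpM2r s0) h1 h2; have := le_trans h2 h1; rewrite lerBlDr -lerBlDl => h3.
rewrite -(ler_pM2l c0); apply: le_trans h3.
(* From [1 - c G <= 2 delta] follows [c G >= 1 - 2 delta], which is [c - delta], that is
   [c (1 - eps)]. *)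
have -> : c * ((1 - eps) * \sum_i nsq (v i)) = (c - delta) * \sum_i nsq (v i).
  by rewrite /delta; ring.
by rewrite cE le_eqVlt; apply/orP; left; apply/eqP; ring.
Qed.

Lemma nat_above (x : R) : 0 <= x -> exists m : nat, x <= m%:R /\ m%:R <= x + 1.
Proof.
move=> x0; have /andP[xl xu] := truncn_itv x0.
by exists (Num.truncn x).+1; rewrite ltW // -natr1 lerD2r.
Qed.

Lemma two_sided_coloring G (eps B : R) (r : nat) : hermitian_mx G ->
  (forall v, 0 <= re (hform G v)) ->
  (forall v, re (hform G v) <= B ^+ 2 * \sum_i nsq (v i)) ->
  (forall i, G i i = 1) ->
  0 < eps -> eps < 1 -> 1 < B -> (6 * (B + 1) / eps) ^+ 4 <= r%:R ->
  exists f : 'I_n -> 'I_r, forall l v, (forall i, f i != l -> v i = 0) ->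
    (1 - eps) * \sum_i nsq (v i) <= re (hform G v) /\
    re (hform G v) <= (1 + eps) * \sum_i nsq (v i).
Proof.
move=> hG psd le_B diag e0 e1 B1 rB.
have [r1 [r1_ge r1_le]] : exists r1 : nat, 24 * B ^+ 2 / eps ^+ 2 <= r1%:R /\
    r1%:R <= 24 * B ^+ 2 / eps ^+ 2 + 1.
  by apply: nat_above; apply: divr_ge0 (sqr_ge0 _); apply: mulr_ge0 (sqr_ge0 _).
have [r2 [r2_ge r2_le]] : exists r2 : nat, 48 / eps <= r2%:R /\ r2%:R <= 48 / eps + 1.
  by apply: nat_above; rewrite divr_ge0 // ltW.
have le_r : (#|{: 'I_r1 * 'I_r2}| <= r)%N.
  rewrite card_prod !card_ord -(ler_nat R); apply: le_trans rB; rewrite natrM.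
  have t1 : 1 < eps^-1 by rewrite invf_gt1.
  move: r1_le r2_le; rewrite exprMn exprMn -exprVn; move: (eps^-1) t1 => t t1 r1_le r2_le.
  have B21 : 1 <= B ^+ 2 by rewrite exprn_ege1 // ltW.
  have t21 : 1 <= t ^+ 2 by rewrite exprn_ege1 // ltW.
  have {}r1_le : r1%:R <= 25 * (B ^+ 2 * t ^+ 2).
    by apply: le_trans r1_le _; have := ler_pM ler01 ler01 B21 t21; lra.
  have {}r2_le : r2%:R <= 49 * t by lra.
  apply: le_trans (ler_pM (ler0n _ _) (ler0n _ _) r1_le r2_le) _.
  (* The two colorings use at most [25 * 49 = 1225] times [B ^+ 2 * t ^+ 3] pairs of colors, and
     [6 ^+ 4 = 1296]. *)
  have -> : 25 * (B ^+ 2 * t ^+ 2) * (49 * t) = 1225 * (B ^+ 2 * t ^+ 3) by ring.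
  have -> : 6 ^+ 4 * (B + 1) ^+ 4 * t ^+ 4 = 1296 * ((B + 1) ^+ 4 * t ^+ 4) by ring.
  apply: ler_pM => //; first by rewrite mulr_ge0 ?exprn_ge0 // ltW // (lt_trans ltr01).
    by rewrite ler_nat.
  apply: ler_pM; rewrite ?exprn_ge0 ?ler_weXn2l //; try lra.
  apply: (@le_trans _ _ ((B + 1) ^+ 2)); first by rewrite lerXn2r ?nnegrE; lra.
  by rewrite ler_weXn2l //; lra.
have [f1 f1P] := upper_coloring hG psd le_B diag e0 e1 B1 r1_ge.
have [f2 f2P] := lower_coloring hG psd f1P diag e0 e1 r2_ge.
pose h (x : 'I_r1 * 'I_r2) : 'I_r := widen_ord le_r (enum_rank x).
have h_inj : injective h.
  by move=> x y /(congr1 val) /= /val_inj /enum_rank_inj.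
exists (fun i => h (f1 i, f2 i)) => l v vl.
have [i0 /eqP hl|none] := pickP (fun i => h (f1 i, f2 i) == l).
  have supp i : (f1 i != f1 i0) || (f2 i != f2 i0) -> v i = 0.
    move=> ne; apply: vl; apply: contraTneq ne; rewrite -hl => /h_inj[-> ->].
    by rewrite !eqxx.
  split.
    apply: (f2P (f1 i0) (f2 i0)) => i ne; apply: supp; rewrite ne ?orbT //.
  by apply: (f1P (f1 i0)) => i ne; apply: supp; rewrite ne.
(* A color that is never attained has an empty class, and then [v] is zero. *)
have v0 i : v i = 0 by apply: vl; rewrite none.
have -> : hform G v = 0.
  by rewrite /hform big1 // => i _; rewrite big1 // => j _; rewrite v0 !mul0r.
by rewrite big1 ?mulr0 // => i _; rewrite v0 nsq0.
Qed.

End TwoSidedColoring.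

Import classical_sets.

(** * Operator norm bounds, for both scalar fields at once *)

Section OperatorNorm.
Variables (R : realType) (K : comNzRingType) (abs : K -> R) (emb : R -> K) (n : nat).
Hypothesis abs_ge0 : forall x, 0 <= abs x.
Hypothesis absM : forall x y, abs (x * y) = abs x * abs y.
Hypothesis absD : forall x y, abs (x + y) <= abs x + abs y.
Hypothesis abs0 : abs 0 = 0.
Hypothesis abs_emb : forall t, abs (emb t) = `|t|.
Implicit Types x : 'rV[K]_n.

Lemma sqr_l2norm x : l2norm abs x ^+ 2 = \sum_i abs (x 0 i) ^+ 2.
Proof. by rewrite sqr_sqrtr // sumr_ge0 // => i _; exact: sqr_ge0. Qed.

Lemma l2norm_ge0 x : 0 <= l2norm abs x.
Proof. exact: sqrtr_ge0. Qed.

Lemma abs_le_l2norm x i : abs (x 0 i) <= l2norm abs x.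
Proof.
rewrite -(ler_pXn2r (ltn0Sn 1)) ?nnegrE ?l2norm_ge0 // sqr_l2norm (bigD1 i) //=.
by rewrite lerDl sumr_ge0 // => j _; exact: sqr_ge0.
Qed.

Lemma abs_sum (I : finType) (F : I -> K) : abs (\sum_i F i) <= \sum_i abs (F i).
Proof.
elim/big_ind2: _ => // [|x y z t xy zt]; first by rewrite abs0.
by apply: le_trans (absD _ _) _; rewrite lerD.
Qed.

Lemma linear_rV_sum (T : {linear 'rV[K]_n -> 'rV[K]_n}) x :
  T x = \sum_i x 0 i *: T (std_basis K i).
Proof.
by rewrite {1}(row_sum_delta x) linear_sum; apply: eq_bigr => i _; rewrite linearZ.
Qed.

(** This crude bound makes the set in [opnorm] bounded; only then does its supremum dominate its
    elements. *)
Lemma l2norm_linear_le (T : {linear 'rV[K]_n -> 'rV[K]_n}) (x : 'rV[K]_n) :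
  (forall i, l2norm abs (T (std_basis K i)) = 1) ->
  l2norm abs (T x) <= Num.sqrt (n%:R * (n%:R * l2norm abs x) ^+ 2).
Proof.
move=> T1; rewrite ler_wsqrtr //.
have -> : n%:R * (n%:R * l2norm abs x) ^+ 2 = \sum_(k < n) (n%:R * l2norm abs x) ^+ 2.
  by rewrite sumr_const card_ord mulr_natl.
apply: ler_sum => k _; rewrite lerXn2r ?nnegrE ?mulr_ge0 ?l2norm_ge0 ?abs_ge0 //.
rewrite linear_rV_sum summxE; apply: le_trans (abs_sum _) _.
have -> : n%:R * l2norm abs x = \sum_(i < n) l2norm abs x.
  by rewrite sumr_const card_ord mulr_natl.
apply: ler_sum => i _; rewrite mxE absM -[leRHS]mulr1.
by apply: ler_pM; rewrite ?abs_ge0 ?abs_le_l2norm // -(T1 i) abs_le_l2norm.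
Qed.

Lemma l2normZ (t : R) x : l2norm abs (emb t *: x) = `|t| * l2norm abs x.
Proof.
rewrite /l2norm -[`|t|]sqrtr_sqr -sqrtrM ?sqr_ge0 // mulr_sumr.
congr Num.sqrt; apply: eq_bigr => i _; rewrite mxE absM abs_emb exprMn.
by rewrite real_normK ?num_real.
Qed.

Lemma opnorm_le (T : {linear 'rV[K]_n -> 'rV[K]_n}) (B : R) x :
  (forall i, l2norm abs (T (std_basis K i)) = 1) -> opnorm abs T <= B ->
  l2norm abs (T x) ^+ 2 <= B ^+ 2 * l2norm abs x ^+ 2.
Proof.
move=> T1 TB.
have bounded : has_ubound [set l2norm abs (T y) | y in [set y | l2norm abs y <= 1]]%classic.
  exists (Num.sqrt (n%:R * n%:R ^+ 2)) => _ [y /= y1 <-].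
  apply: le_trans (l2norm_linear_le y T1) _; rewrite ler_wsqrtr // ler_wpM2l //.
  rewrite lerXn2r ?nnegrE ?mulr_ge0 ?l2norm_ge0 //.
  by rewrite -[leRHS]mulr1 ler_wpM2l.
(* A vector of norm zero cannot be normalized; the crude bound shows that its image has norm
   zero. *)
have [x0|x0] := eqVneq (l2norm abs x) 0.
  have := l2norm_linear_le x T1; rewrite x0 mulr0 expr0n mulr0 sqrtr0 => Tx0.
  have -> : l2norm abs (T x) = 0 by apply/eqP; rewrite eq_le Tx0 l2norm_ge0.
  by rewrite expr0n mulr0.
have xpos : 0 < l2norm abs x by rewrite lt_neqAle eq_sym x0 l2norm_ge0.
have : l2norm abs (T (emb (l2norm abs x)^-1 *: x)) <= B.
  apply: le_trans TB; apply: ub_le_sup => //.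
  exists (emb (l2norm abs x)^-1 *: x) => //=.
  by rewrite l2normZ ger0_norm ?invr_ge0 ?l2norm_ge0 // mulVf.
rewrite linearZ l2normZ ger0_norm ?invr_ge0 ?l2norm_ge0 // ler_pdivrMl // => h.
rewrite mulrC -exprMn lerXn2r ?nnegrE ?l2norm_ge0 //.
exact: le_trans (l2norm_ge0 _) h.
Qed.

Lemma opnorm_comb_le (T : {linear 'rV[K]_n -> 'rV[K]_n}) (B : R) (a : 'I_n -> K) :
  (forall i, l2norm abs (T (std_basis K i)) = 1) -> opnorm abs T <= B ->
  l2norm abs (\sum_i a i *: T (std_basis K i)) ^+ 2 <= B ^+ 2 * \sum_i abs (a i) ^+ 2.
Proof.
move=> T1 TB.
have -> : \sum_i a i *: T (std_basis K i) = T (\row_i a i).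
  by rewrite linear_rV_sum; apply: eq_bigr => i _; rewrite mxE.
have -> : \sum_i abs (a i) ^+ 2 = l2norm abs (\row_i a i) ^+ 2.
  by rewrite sqr_l2norm; apply: eq_bigr => i _; rewrite mxE.
exact: opnorm_le.
Qed.

End OperatorNorm.

(** * Gram matrices and transfer to the two scalar fields *)

Section Frames.
Variables (R : realType) (n : nat).
Implicit Types (X : 'I_n -> 'I_n -> R[i]) (v : 'I_n -> R[i]).
Notation toC := (real_complex R).

Definition frame_sq X v : R := \sum_k nsq (\sum_i v i * X i k).

Lemma frame_coloring X (eps B : R) (r : nat) :
  (forall v, frame_sq X v <= B ^+ 2 * \sum_i nsq (v i)) ->
  (forall i, \sum_k nsq (X i k) = 1) ->
  0 < eps -> eps < 1 -> 1 < B -> (6 * (B + 1) / eps) ^+ 4 <= r%:R ->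
  exists f : 'I_n -> 'I_r, forall l v, (forall i, f i != l -> v i = 0) ->
    (1 - eps) * \sum_i nsq (v i) <= frame_sq X v /\
    frame_sq X v <= (1 + eps) * \sum_i nsq (v i).
Proof.
move=> le_B X1 e0 e1 B1 rB.
pose G : 'M[R[i]]_n := \matrix_(i, j) \sum_k X i k * (X j k)^*%C.
have hG : hermitian_mx G.
  move=> i j; rewrite !mxE rmorph_sum; apply: eq_bigr => k _.
  by rewrite rmorphM /= conjcK mulrC.
have hformG v : complex.Re (hform G v) = frame_sq X v.
  suff -> : hform G v = toC (frame_sq X v) by [].
  rewrite /hform /frame_sq rmorph_sum.
  transitivity (\sum_k \sum_i \sum_j v i * X i k * (v j * X j k)^*%C).
    rewrite [RHS]exchange_big; apply: eq_bigr => i _.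
    rewrite [RHS]exchange_big; apply: eq_bigr => j _ /=.
    rewrite mxE mulr_sumr mulr_suml; apply: eq_bigr => k _.
    by rewrite rmorphM mulrA mulrA mulrAC.
  apply: eq_bigr => k _ /=; rewrite -mulc_conj rmorph_sum mulr_suml.
  by apply: eq_bigr => i _; rewrite mulr_sumr.
have [|||f fP] := @two_sided_coloring R n G eps B r hG _ _ _ e0 e1 B1 rB.
- by move=> v; rewrite hformG sumr_ge0 // => k _; exact: nsq_ge0.
- by move=> v; rewrite hformG.
- move=> i; rewrite mxE; apply/eqP; rewrite -(rmorph1 toC) -(X1 i) rmorph_sum; apply/eqP.
  by apply: eq_bigr => k _; exact: mulc_conj.
by exists f => l v /fP; rewrite hformG.
Qed.

Lemma fibers_partition (r : nat) (f : 'I_n -> 'I_r) :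
  is_partition_family (fun j => [set i | f i == j]%SET).
Proof.
split=> [j k jk|].
  rewrite -setI_eq0; apply/eqP/setP => i; rewrite !inE.
  by apply/negP => /andP[/eqP -> /eqP jk']; rewrite jk' eqxx in jk.
by apply/setP => i; rewrite inE; apply/bigcupP; exists (f i); rewrite ?inE.
Qed.

Lemma absC_sqr (z : R[i]) : absC z ^+ 2 = nsq z.
Proof. by rewrite /absC normc_def /= sqr_sqrtr // nsq_ge0. Qed.

Lemma absC_ge0 (z : R[i]) : 0 <= absC z.
Proof. by rewrite /absC normc_def sqrtr_ge0. Qed.

Lemma absCM (z w : R[i]) : absC (z * w) = absC z * absC w.
Proof. by rewrite /absC normrM !normc_def -rmorphM. Qed.

Lemma absCD (z w : R[i]) : absC (z + w) <= absC z + absC w.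
Proof. by have := ler_normD z w; rewrite lecE raddfD => /andP[_]. Qed.

Lemma absC_real (t : R) : absC (toC t) = `|t|.
Proof. by rewrite /absC normc_def /= expr0n addr0 sqrtr_sqr. Qed.

End Frames.

Lemma sum_mkcond_scale (K : nzRingType) (n m : nat) (S : {set 'I_n}) (a : 'I_n -> K)
    (x : 'I_n -> 'rV[K]_m) :
  \sum_(i in S) a i *: x i = \sum_i (if i \in S then a i else 0) *: x i.
Proof. by rewrite big_mkcond; apply: eq_bigr => i _; case: ifP; rewrite ?scale0r. Qed.

Lemma sum_mkcond_abs (K : nzRingType) (R : realType) (abs : K -> R) (n : nat)
    (S : {set 'I_n}) (a : 'I_n -> K) : abs 0 = 0 ->
  \sum_(i in S) abs (a i) ^+ 2 = \sum_i abs (if i \in S then a i else 0) ^+ 2.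
Proof.
by move=> abs0; rewrite big_mkcond; apply: eq_bigr => i _; case: ifP; rewrite ?abs0 ?expr0n.
Qed.

(** Real vectors are viewed as complex ones. With complex coefficients the squared norm splits into
    the contributions of their real and imaginary parts, so the bound by [B] carries over. *)
Lemma real_case (R : realType) (eps B : R) (r n : nat) (T : {linear 'rV[R]_n -> 'rV[R]_n}) :
  0 < eps -> eps < 1 -> 1 < B -> (6 * (B + 1) / eps) ^+ 4 <= r%:R ->
  opnorm (@absR R) T <= B ->
  (forall i : 'I_n, l2norm (@absR R) (T (std_basis R i)) = 1) ->
  exists S : 'I_r -> {set 'I_n}, is_partition_family S /\
    forall (j : 'I_r) (a : 'I_n -> R),
      (1 - eps) * (\sum_(i in S j) absR (a i) ^+ 2)
        <= l2norm (@absR R) (\sum_(i in S j) a i *: T (std_basis R i)) ^+ 2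
      /\
      l2norm (@absR R) (\sum_(i in S j) a i *: T (std_basis R i)) ^+ 2
        <= (1 + eps) * (\sum_(i in S j) absR (a i) ^+ 2).
Proof.
move=> e0 e1 B1 rB TB T1.
pose X i k := real_complex R (T (std_basis R i) 0 k).
have sq_absR (x : R) : absR x ^+ 2 = x ^+ 2 by rewrite /absR real_normK ?num_real.
have normE (a : 'I_n -> R) : l2norm (@absR R) (\sum_i a i *: T (std_basis R i)) ^+ 2
    = \sum_k (\sum_i a i * T (std_basis R i) 0 k) ^+ 2.
  rewrite sqr_l2norm; apply: eq_bigr => k _; rewrite sq_absR summxE.
  by congr (_ ^+ 2); apply: eq_bigr => i _; rewrite mxE.
have frameE v : frame_sq X v =
    l2norm (@absR R) (\sum_i complex.Re (v i) *: T (std_basis R i)) ^+ 2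
    + l2norm (@absR R) (\sum_i complex.Im (v i) *: T (std_basis R i)) ^+ 2.
  rewrite !normE -big_split; apply: eq_bigr => k _ /=; rewrite /nsq.
  by congr (_ ^+ 2 + _ ^+ 2); rewrite raddf_sum; apply: eq_bigr => i _;
    [exact: re_mulr|exact: im_mulr].
have absR0 : absR (0 : R) = 0 by rewrite /absR normr0.
have combE a := @opnorm_comb_le R R (@absR R) id n (@normr_ge0 _ _) (@normrM R)
  (@ler_normD _ _) absR0 (fun t => erefl) T B a T1 TB.
have [v||f fP] := @frame_coloring R n X eps B r _ _ e0 e1 B1 rB.
- rewrite frameE; apply: le_trans (lerD (combE _) (combE _)) _.
  rewrite -mulrDr -big_split ler_wpM2l ?sqr_ge0 //; apply: ler_sum => i _ /=.
  by rewrite !sq_absR.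
- move=> i; rewrite -[RHS](expr1n _ 2) -(T1 i) sqr_l2norm; apply: eq_bigr => k _.
  by rewrite sq_absR /nsq /= expr0n addr0.
exists (fun j => [set i | f i == j]%SET); split; first exact: fibers_partition.
move=> j a; rewrite sum_mkcond_scale sum_mkcond_abs //.
pose b i := if i \in [set i | f i == j]%SET then a i else 0.
have bE i : f i != j -> real_complex R (b i) = 0.
  by rewrite /b inE => /negPf ->.
have := fP j (fun i => real_complex R (b i)) bE; rewrite frameE /=.
have -> : \sum_i nsq (real_complex R (b i)) = \sum_i absR (b i) ^+ 2.
  by apply: eq_bigr => i _; rewrite sq_absR /nsq /= expr0n addr0.
have -> : \sum_i 0 *: T (std_basis R i) = 0 by rewrite big1 // => i _; rewrite scale0r.
have -> : l2norm (@absR R) (0 : 'rV_n) ^+ 2 = 0.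
  by rewrite sqr_l2norm big1 // => i _; rewrite mxE absR0 expr0n.
by rewrite addr0.
Qed.

Lemma complex_case (R : realType) (eps B : R) (r n : nat)
    (T : {linear 'rV[R[i]]_n -> 'rV[R[i]]_n}) :
  0 < eps -> eps < 1 -> 1 < B -> (6 * (B + 1) / eps) ^+ 4 <= r%:R ->
  opnorm (@absC R) T <= B ->
  (forall i : 'I_n, l2norm (@absC R) (T (std_basis R[i] i)) = 1) ->
  exists S : 'I_r -> {set 'I_n}, is_partition_family S /\
    forall (j : 'I_r) (a : 'I_n -> R[i]),
      (1 - eps) * (\sum_(i in S j) absC (a i) ^+ 2)
        <= l2norm (@absC R) (\sum_(i in S j) a i *: T (std_basis R[i] i)) ^+ 2
      /\
      l2norm (@absC R) (\sum_(i in S j) a i *: T (std_basis R[i] i)) ^+ 2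
        <= (1 + eps) * (\sum_(i in S j) absC (a i) ^+ 2).
Proof.
move=> e0 e1 B1 rB TB T1.
pose X i k := T (std_basis R[i] i) 0 k.
have frameE v : frame_sq X v =
    l2norm (@absC R) (\sum_i v i *: T (std_basis R[i] i)) ^+ 2.
  rewrite sqr_l2norm; apply: eq_bigr => k _; rewrite absC_sqr summxE.
  by congr nsq; apply: eq_bigr => i _; rewrite mxE.
have sumE (v : 'I_n -> R[i]) : \sum_i nsq (v i) = \sum_i absC (v i) ^+ 2.
  by apply: eq_bigr => i _; rewrite absC_sqr.
have absC0 : absC (0 : R[i]) = 0 by rewrite /absC normr0.
have combE a := @opnorm_comb_le R R[i] (@absC R) (real_complex R) n (@absC_ge0 R) (@absCM R)
  (@absCD R) absC0 (@absC_real R) T B a T1 TB.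
have [v||f fP] := @frame_coloring R n X eps B r _ _ e0 e1 B1 rB.
- by rewrite frameE sumE; exact: combE.
- by move=> i; rewrite sumE -sqr_l2norm T1 expr1n.
exists (fun j => [set i | f i == j]%SET); split; first exact: fibers_partition.
move=> j a; rewrite sum_mkcond_scale sum_mkcond_abs // -sumE -frameE.
by apply: (fP j) => i; rewrite inE => /negPf ->.
Qed.

Theorem theorem5p5 (R : realType) (eps B : R) :
  0 < eps -> eps < 1 -> 1 < B ->
  (forall r : nat, r%:Z = Num.ceil ((6 * (B + 1) / eps) ^+ 4) ->
   forall (n : nat) (T : {linear 'rV[R]_n -> 'rV[R]_n}),
     opnorm (@absR R) T <= B ->
     (forall i : 'I_n, l2norm (@absR R) (T (std_basis R i)) = 1) ->
     exists S : 'I_r -> {set 'I_n}, is_partition_family S /\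
       forall (j : 'I_r) (a : 'I_n -> R),
         (1 - eps) * (\sum_(i in S j) absR (a i) ^+ 2)
           <= l2norm (@absR R) (\sum_(i in S j) a i *: T (std_basis R i)) ^+ 2
         /\
         l2norm (@absR R) (\sum_(i in S j) a i *: T (std_basis R i)) ^+ 2
           <= (1 + eps) * (\sum_(i in S j) absR (a i) ^+ 2))
  /\
  (forall r : nat, r%:Z = Num.ceil ((6 * (B + 1) / eps) ^+ 8) ->
   forall (n : nat) (T : {linear 'rV[R[i]]_n -> 'rV[R[i]]_n}),
     opnorm (@absC R) T <= B ->
     (forall i : 'I_n, l2norm (@absC R) (T (std_basis R[i] i)) = 1) ->
     exists S : 'I_r -> {set 'I_n}, is_partition_family S /\
       forall (j : 'I_r) (a : 'I_n -> R[i]),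
         (1 - eps) * (\sum_(i in S j) absC (a i) ^+ 2)
           <= l2norm (@absC R) (\sum_(i in S j) a i *: T (std_basis R[i] i)) ^+ 2
         /\
         l2norm (@absC R) (\sum_(i in S j) a i *: T (std_basis R[i] i)) ^+ 2
           <= (1 + eps) * (\sum_(i in S j) absC (a i) ^+ 2)).
Proof.
move=> e0 e1 B1.
have ceil_bound (r : nat) (x : R) : r%:Z = Num.ceil x -> x <= r%:R.
  by move=> rE; rewrite -[r%:R]/((r%:Z)%:~R) rE Num.Theory.ceil_ge.
split=> r /ceil_bound rB n T; first exact: real_case.
(* The fourth power already suffices; the eighth exceeds it because the base is at least 1. *)
apply: complex_case => //; apply: le_trans rB; rewrite ler_weXn2l //.
rewrite ler_pdivlMr // mul1r; lra.
Qed.
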